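(* Every $10$-tough chordal graph on at least $3$ vertices is Hamiltonian.
   Context: A graph is chordal if it has no induced cycle of length at least $4$. The toughness of a non-complete graph $G$ is the minimum, over all separating sets $S\subseteq V(G)$ (sets whose removal leaves a disconnected graph), of $|S|/c(G-S)$, where $c(G-S)$ is the number of components of $G-S$; the toughness of a complete graph is defined to be $\infty$. A graph is $t$-tough if its toughness is at least $t$. *)

(* Defs.v *)
From mathcomp Require Import all_boot all_order all_algebra.
From mathcomp Require Import constructive_ereal.

Set Implicit Arguments.
Unset Strict Implicit.
Unset Printing Implicit Defensive.

Import Order.TTheory GRing.Theory Num.Theory.

(* A finite simple graph is a symmetric irreflexive relation e on a finType.  *)

Section Graphs.
Variables (T : finType) (e : rel T).

Definition simple_graph : Prop := symmetric e /\ irreflexive e.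

Definition complete_graph : bool :=
  [forall x : T, forall y : T, (x != y) ==> e x y].

(* ucycle alone also accepts the empty sequence and, in a simple graph, the
   degenerate 2-cycle running back and forth along one edge. *)
Definition graph_cycle (c : seq T) : Prop := ucycle e c /\ 2 < size c.

(* Every edge joining two vertices of c is an edge of the cycle c. *)
Definition induced_cycle (c : seq T) : Prop :=
  graph_cycle c /\
  {in c &, forall x y, e x y -> next c x = y \/ next c y = x}.

Definition chordal : Prop :=
  ~ exists c : seq T, induced_cycle c /\ 4 <= size c.

Definition hamiltonian : Prop :=
  exists c : seq T, graph_cycle c /\ (forall x : T, x \in c).

Definition del_rel (S : {set T}) : rel T :=
  [rel x y | [&& x \notin S, y \notin S & e x y]].

Definition ncomp_del (S : {set T}) : nat := n_comp (del_rel S) (~: S).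

Definition separating (S : {set T}) : bool := 1 < ncomp_del S.

(* In a non-complete graph the range of the minimum is nonempty (it contains
   the complement of any pair of non-adjacent vertices), so the neutral element
   +oo plays no role there. *)
Definition toughness : \bar rat :=
  if complete_graph then +oo%E
  else \big[Order.min/+oo%E]_(S : {set T} | separating S)
         ((#|S|%:R / (ncomp_del S)%:R)%R%:E)%E.

Definition tough (t : rat) : Prop := (t%:E <= toughness)%E.

End Graphs.

(* Main.v *)
Require Import Defs.
From mathcomp Require Import all_boot all_order all_algebra all_fingroup.
From mathcomp Require Import constructive_ereal zify.

Set Implicit Arguments.
Unset Strict Implicit.
Unset Printing Implicit Defensive.

Import Order.TTheory GRing.Theory Num.Theory.

(** Let [X] be the independent set chosen greedily along a perfect elimination order, and let
    [Q x] consist of [x] and its later neighbours: the cliques [Q x], for [x] in [X], cover the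
    graph. A link from [x] to [y] is a common vertex of [Q x] and [Q y], or an edge between them.
    If the multigraph of links on [X] contains two spanning trees all of whose links are pairwise
    disjoint, then adding to the first tree a T-join inside the second gives a connected even
    multigraph; an Euler circuit of it runs through the cliques, and picks up in [Q x] all the
    vertices that are not yet used: this is a Hamilton cycle.

    The two trees come from a topological Hall theorem for the matching complex of the links and
    the graphic matroid (Aharoni-Haxell, Aharoni-Berger), proved here with chains modulo 2. What it
    requires is that every partition of [X] into [q > 1] parts has at least [4q - 5] disjoint links
    between different parts. If there are fewer, the Tutte-Berge formula and Hall's theorem give two
    cuts whose total size is at most [8q - 12] and which leave together at least [q] components,
    against toughness 10. *)

(** * Chains modulo 2 *)

(** Both trees are found at once: take two disjoint copies of the link multigraph, let a link
    conflict with its copies and with every link sharing a vertex with it, and look for a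
    conflict-free set of links with only two components. Conflicts are about vertices because the
    Hamilton cycle visits each vertex of a link once. In the topological Hall theorem every link has
    two options, kept or deleted: the kept links must be conflict-free, and removing the deleted
    ones must leave at most two components.

    The number 4q - 5 arises as follows. If a set of links has m > 2 components in the two copies,
    one copy has q of them with 2q >= m. The disjoint crossing links of that copy must not all be
    hit by m - 3 links; these have at most 2(m - 3) <= 4q - 6 vertices. *)

Section Chains.
Variable V : finType.
Local Open Scope ring_scope.

Notation chain := {ffun {set V} -> 'F_2}.
Implicit Types (c z w : chain) (s t : {set V}) (K : pred {set V}) (d n : nat).

Lemma addF2 (x : 'F_2) : x + x = 0.
Proof. by case: x => [[|[|[]]]] //= i; apply/val_inj. Qed.

Lemma addcc c : c + c = 0.
Proof. by apply/ffunP => s; rewrite !ffunE addF2. Qed.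

(** The pairs (i, j) and (j, i) cancel modulo 2. This makes the boundary square to zero and the
    right-hand sides in [chain_system] cycles. *)
Lemma sum_sym_F2 (I : finType) (P : pred I) (F : I -> I -> 'F_2) :
  (forall i j, F i j = F j i) ->
  \sum_(i | P i) \sum_(j | P j && (j != i)) F i j = 0.
Proof.
move=> symF.
pose lt (i j : I) := (enum_rank i < enum_rank j)%N.
have -> : \sum_(i | P i) \sum_(j | P j && (j != i)) F i j =
  \sum_(i | P i) \sum_(j | P j && lt i j) F i j +
  \sum_(i | P i) \sum_(j | P j && lt j i) F i j.
  rewrite -big_split /=; apply: eq_bigr => i _.
  rewrite (bigID (fun j => lt i j)) /=; congr (_ + _); apply: eq_bigl => j.
    rewrite -andbA; congr (_ && _); rewrite andbC /lt.
    by case: (j =P i) => [->|_]; rewrite ?ltnn //= andbT.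
  rewrite -andbA; congr (_ && _); rewrite /lt -leqNgt leq_eqVlt andbC.
  rewrite (inj_eq val_inj) (inj_eq enum_rank_inj).
  by case: (j =P i) => [->|_] /=; rewrite ?ltnn //= andbT.
rewrite [X in _ + X](exchange_big_dep P) /=; last by move=> i j _ /andP[].
have -> : \sum_(j | P j) \sum_(i | P i && (P j && lt j i)) F i j =
          \sum_(i | P i) \sum_(j | P j && lt i j) F i j.
  apply: eq_bigr => i Pi; rewrite Pi /=; apply: eq_bigr => j _; exact: symF.
exact: addF2.
Qed.

Definition bnd c : chain := [ffun t : {set V} => \sum_(v | v \notin t) c (v |: t)].
Definition cone v c : chain := [ffun s : {set V} => if v \in s then c (s :\ v) else 0].

Lemma bndD c1 c2 : bnd (c1 + c2) = bnd c1 + bnd c2.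
Proof. by apply/ffunP => t; rewrite !ffunE -big_split; apply: eq_bigr => v _; rewrite ffunE. Qed.

Lemma bnd0 : bnd 0 = 0.
Proof. by apply/ffunP => t; rewrite !ffunE big1 // => v _; rewrite ffunE. Qed.

Lemma bnd_sum (I : finType) (P : pred I) (F : I -> chain) :
  bnd (\sum_(i | P i) F i) = \sum_(i | P i) bnd (F i).
Proof. by apply: (big_morph bnd bndD bnd0). Qed.

Lemma bnd_bnd c : bnd (bnd c) = 0.
Proof.
apply/ffunP => t; rewrite !ffunE.
rewrite -[RHS](@sum_sym_F2 _ (fun v => v \notin t) (fun u v => c (v |: (u |: t)))).
  apply: eq_bigr => u ut; rewrite ffunE; apply: eq_bigl => v.
  by rewrite in_setU1 negb_or andbC.
by move=> u v; rewrite setUCA.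
Qed.

(** At a face [t] containing [v], the boundary of [c] at [t :\ v] includes the term [c t]; it
    cancels the first summand, so the formula also covers chains whose faces contain [v]. *)
Lemma bnd_cone v c : bnd (cone v c) = c + cone v (bnd c).
Proof.
apply/ffunP => t; rewrite !ffunE.
have [vt|vt] := boolP (v \in t).
  rewrite [in RHS](bigD1 v) /=; last by rewrite setD11.
  rewrite setD1K // addrA addF2 add0r; apply: eq_big => [u|u ut].
    by rewrite in_setD1; case: (u =P v) => [->|_]; rewrite ?vt ?andbT //= andbT.
  rewrite ffunE in_setU1 vt orbT; congr (c _).
  apply/setP => x; rewrite !inE; case: (x =P v) => [->|] //=.
  by case: (v =P u) ut => [<-|//]; rewrite vt.
rewrite (bigD1 v) //= big1 => [|u /andP[ut uv]]; last first.
  by rewrite ffunE in_setU1 eq_sym (negPf uv) (negPf vt).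
by rewrite ffunE setU11 setU1K.
Qed.

Definition supported K d c := forall s, c s != 0 -> K s /\ #|s| = d.

Lemma supp_out K d c s : supported K d c -> ~~ K s -> c s = 0.
Proof. by move=> sc nK; case: (c s =P 0) => // /eqP /sc [Ks]; rewrite Ks in nK. Qed.

Lemma suppD K d c1 c2 : supported K d c1 -> supported K d c2 -> supported K d (c1 + c2).
Proof.
move=> s1 s2 s; rewrite ffunE; have [-> | n1] := eqVneq (c1 s) 0; last by move=> _; apply: s1.
by rewrite add0r; apply: s2.
Qed.

Definition downclosed K := forall s t, t \subset s -> K s -> K t.

Lemma supp_bnd K d c : downclosed K -> supported K d.+1 c -> supported K d (bnd c).
Proof.
move=> dK sc s; rewrite ffunE => nz.
have /existsP[v /andP[vs nv]] : [exists v, (v \notin s) && (c (v |: s) != 0)].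
  apply: contraNT nz => /existsPn H; rewrite big1 // => v vs.
  by apply/eqP; have := H v; rewrite vs negbK.
have [Kv cv] := sc _ nv; split; first exact: dK (subsetUr _ _) Kv.
by move: cv; rewrite cardsU1 vs add1n => -[].
Qed.

Lemma supp_sum K d (I : finType) (P : pred I) (F : I -> chain) :
  (forall i, P i -> supported K d (F i)) -> supported K d (\sum_(i | P i) F i).
Proof.
move=> sF; elim/big_ind: _ => // [s|]; first by rewrite ffunE eqxx.
exact: suppD.
Qed.

(* Degrees count vertices: [acyc K d] says that the reduced homology of [K] vanishes in
   dimension [d - 1]. *)
Definition acyc K d := forall z, supported K d z -> bnd z = 0 ->
  exists2 w, supported K d.+1 w & bnd w = z.

(** Homological (n - 2)-connectedness, degrees being numbers of vertices: [conn K 1] says that a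
    complex with the empty face has a vertex. *)
Definition conn K n := forall d, (d < n)%N -> acyc K d.

Lemma conn_le K m n : (m <= n)%N -> conn K n -> conn K m.
Proof. by move=> mn cK d dm; apply: cK; apply: leq_trans dm mn. Qed.

Lemma eq_conn K1 K2 n : K1 =1 K2 -> conn K1 n -> conn K2 n.
Proof.
move=> eK cK d dn z sz bz; have [|w sw bw] := cK d dn z _ bz.
  by move=> s /sz; rewrite eK.
by exists w => // s /sw; rewrite eK.
Qed.

Lemma conn_cone K v n : (forall s, K s -> K (v |: s)) -> downclosed K -> conn K n.
Proof.
move=> Kv dK d _ z sz bz; exists (cone v z); last by rewrite bnd_cone bz; apply/ffunP => t; rewrite !ffunE; case: ifP; rewrite ?ffunE addr0.
move=> s; rewrite ffunE; case: ifP => [vs /sz [Ks cs]|]; last by rewrite eqxx.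
split; first by rewrite -(setD1K vs); apply: Kv.
by rewrite (cardsD1 v) vs cs.
Qed.

Definition link v K : pred {set V} := fun s => (v \notin s) && K (v |: s).
Definition del v K : pred {set V} := fun s => (v \notin s) && K s.

(* Split [z] as [z0 + v * z1]; the link fills [z1], which pushes [z] into the deletion. *)
Lemma conn_vertex K v n : downclosed K ->
  conn (del v K) n -> conn (link v K) n.-1 -> conn K n.
Proof.
move=> dK cD cL d dn z sz bz.
have subD d' c : supported (del v K) d' c -> supported K d' c.
  by move=> sc s /sc [/andP[_ Ks] cs].
pose z1 : chain := [ffun s : {set V} => if v \in s then 0 else z (v |: s)].
case: d dn sz => [|d] dn sz.
  have [|w sw bw] := cD 0%N dn z _ bz; last by exists w => //; apply: subD.
  move=> s nz; have [Ks /eqP cs] := sz s nz; split; last exact/eqP.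
  by rewrite /del Ks andbT; move: cs; rewrite cards_eq0 => /eqP ->; rewrite inE.
have sz1 : supported (link v K) d z1.
  move=> s; rewrite ffunE; case: ifP => [|/negbT vs nz]; first by rewrite eqxx.
  have [Ks cs] := sz _ nz; rewrite /link vs Ks; split=> //.
  by move: cs; rewrite cardsU1 vs add1n => -[].
have bz1 : bnd z1 = 0.
  apply/ffunP => t; rewrite !ffunE; have [vt|vt] := boolP (v \in t).
    by apply: big1 => u ut; rewrite ffunE in_setU1 vt orbT.
  move/ffunP/(_ (v |: t)): bz; rewrite !ffunE => E; rewrite -[RHS]E.
  rewrite (bigD1 v) //= ffunE setU11 add0r; apply: eq_big => [u|u /andP[ut uv]].
    by rewrite in_setU1 negb_or andbC.
  by rewrite ffunE in_setU1 eq_sym (negPf uv) (negPf vt) setUCA.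
have [u su bu] : exists2 u, supported (link v K) d.+1 u & bnd u = z1.
  by apply: cL => //; rewrite -ltnS (ltn_predK dn).
have scu : supported K d.+2 (cone v u).
  move=> s; rewrite ffunE; case: ifP => [vs /su [/andP[_ Ks] cs]|]; last by rewrite eqxx.
  by split; [rewrite -(setD1K vs) | rewrite (cardsD1 v) vs cs].
have [||w sw bw] := cD d.+1 dn (z + bnd (cone v u)).
- move=> s nz; have [Ks cs] := suppD sz (supp_bnd dK scu) nz; split=> //.
  rewrite /del Ks andbT; apply/negP => vs; case/negP: nz; apply/eqP.
  rewrite bnd_cone bu !ffunE vs setD11 setD1K //.
  rewrite (supp_out su) ?add0r ?addF2 //.
  by rewrite /link vs.
- by rewrite bndD bz bnd_bnd addr0.
exists (w + cone v u); first exact: suppD (subD _ _ sw) scu.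
by rewrite bndD bw -addrA addcc addr0.
Qed.

(* Meshulam's edge lemma: [K'] is [K] plus the faces containing both [x] and [y]. *)
Lemma conn_edge K K' x y n : x != y -> downclosed K' ->
  (forall s, K s = K' s && ~~ ((x \in s) && (y \in s))) ->
  conn K' n -> conn (link x (link y K')) n.-1 -> conn K n.
Proof.
move=> xy dK' eK cK' cL d dn z sz bz.
have [|w sw bw] := cK' d dn z _ bz; first by move=> s /sz []; rewrite eK => /andP[].
(* [w1] reads off the faces of [w] containing both [x] and [y], which have to disappear. *)
pose w1 : chain := [ffun s : {set V} => if (x \in s) || (y \in s) then 0 else w (y |: (x |: s))].
case: d dn sz sw => [|d] dn sz sw.
  exists w => // s nz; have [Ks cs] := sw s nz; split => //.
  rewrite eK Ks /=; move/eqP/cards1P: cs => [a ->]; rewrite !inE.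
  by apply: contra xy => /andP[/eqP -> /eqP ->].
have sw1 : supported (link x (link y K')) d w1.
  move=> s; rewrite ffunE; case: ifP => [|/norP[xs ys] nz]; first by rewrite eqxx.
  have [Ks cs] := sw _ nz.
  have yxs : y \notin x |: s by rewrite !inE negb_or eq_sym xy.
  rewrite /link xs yxs Ks; split=> //.
  by move: cs; rewrite !cardsU1 xs yxs !add1n => -[].
have bw1 : bnd w1 = 0.
  apply/ffunP => t; rewrite !ffunE; have [xyt|xyt] := boolP ((x \in t) || (y \in t)).
    by apply: big1 => u ut; rewrite ffunE !in_setU1; case/orP: xyt => ->; rewrite !orbT.
  have [xt yt] := norP xyt.
  have yxt : y \notin x |: t by rewrite !inE negb_or eq_sym xy.
  have : bnd w (y |: (x |: t)) = 0.
    rewrite bw; apply: (supp_out sz); by rewrite eK !inE !eqxx orbT /= andbF.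
  rewrite ffunE => E; rewrite -[RHS]E (bigD1 x) //= ffunE setU11 add0r.
  rewrite (bigD1 y) /=; last by rewrite yt eq_sym.
  rewrite ffunE setU11 orbT add0r; apply: eq_big => [u|u /andP[/andP[ut ux] uy]].
    by rewrite !in_setU1 !negb_or; case: (u \notin t); case: (u != x); case: (u != y).
  rewrite ffunE !in_setU1 ![x == u]eq_sym ![y == u]eq_sym (negPf ux) (negPf uy).
  rewrite (negPf xt) (negPf yt) /=; congr (w _).
  by rewrite [RHS]setUCA; congr (_ |: _); rewrite setUCA.
have [u su bu] : exists2 u, supported (link x (link y K')) d.+1 u & bnd u = w1.
  by apply: cL => //; rewrite -ltnS (ltn_predK dn).
have uE s : (x \in s) || (y \in s) -> u s = 0.
  move=> xys; apply: (supp_out su); rewrite /link !inE.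
  by case/orP: xys => ->; rewrite ?orbT //= andbF.
have suyx : supported K' d.+3 (cone y (cone x u)).
  move=> s; rewrite !ffunE; case: ifP => [ys|]; last by rewrite eqxx.
  case: ifP => [xs /su [/andP[_ /andP[_ Ks]] cs]|]; last by rewrite eqxx.
  split; first by rewrite -(setD1K ys) -(setD1K xs).
  by rewrite (cardsD1 y) ys (cardsD1 x) xs cs.
(* Adding this boundary does not change the boundary of [w], and it cancels [w] on every face
   containing both [x] and [y]. *)
exists (w + bnd (cone y (cone x u))); last by rewrite bndD bnd_bnd addr0.
move=> s nz; have [Ks cs] := suppD sw (supp_bnd dK' suyx) nz; split=> //.
rewrite eK Ks /=; apply/negP => /andP[xs ys]; case/negP: nz; apply/eqP.
have xsy : x \in s :\ y by rewrite !inE xy xs.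
have ysx : y \in s :\ x by rewrite !inE eq_sym xy ys.
rewrite !bnd_cone bu !ffunE ys xs xsy !setD11 !in_setD1 eqxx andbF /=.
rewrite (uE (s :\ x)) ?ysx ?orbT // (uE (s :\ y)) ?xsy // !add0r.
by rewrite setD1K // setD1K // addF2.
Qed.

End Chains.

(** * Spanning multigraphs without conflicts *)

Section Multigraph.
Variables (Y E : finType) (src tgt : E -> Y).
Implicit Types (F : {set E}).

Definition madj F : rel Y := fun y z =>
  [exists e in F, ((src e == y) && (tgt e == z)) || ((src e == z) && (tgt e == y))].
Definition mclass F y : {set Y} := [set z | connect (madj F) y z].
Definition mcomp F := #|[set mclass F y | y in Y]|.

Lemma madj_sym F : connect_sym (madj F).
Proof.
apply: sym_connect_sym => y z; apply: eq_existsb => x; congr (_ && _); exact: orbC.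
Qed.

Lemma mclass_id F y : y \in mclass F y.
Proof. by rewrite inE connect0. Qed.

Lemma mclass_eqP F y z : reflect (mclass F y = mclass F z) (connect (madj F) y z).
Proof.
apply: (iffP idP) => [yz|Eyz]; last by have := mclass_id F z; rewrite -Eyz inE.
by apply/setP => x; rewrite !inE (same_connect (madj_sym F) yz).
Qed.

Lemma mclass_edge F x : x \in F -> mclass F (src x) = mclass F (tgt x).
Proof.
move=> xF; apply/mclass_eqP/connect1/existsP; exists x.
by rewrite xF !eqxx.
Qed.

Lemma sub_madj F F' : F \subset F' -> subrel (madj F) (madj F').
Proof.
move=> sF y z /existsP[x /andP[xF xyz]]; apply/existsP; exists x.
by rewrite (subsetP sF).
Qed.

Lemma mclass_sub F F' y z : F \subset F' -> mclass F y = mclass F z -> mclass F' y = mclass F' z.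
Proof.
move=> sF /mclass_eqP yz; apply/mclass_eqP; apply: connect_sub yz => a b ab.
exact/connect1/(sub_madj sF).
Qed.

Lemma bigcup_mclass F F' y : F \subset F' ->
  \bigcup_(z in mclass F y) mclass F' z = mclass F' y.
Proof.
move=> sF; apply/setP => x; apply/bigcupP/idP => [[z]|xy]; last by exists y; rewrite ?mclass_id.
by rewrite inE => /mclass_eqP/(mclass_sub sF) ->.
Qed.

(** Components of [F'] are unions of components of [F]. Comparing their numbers thus becomes a
    question of injectivity of a map on components. *)
Lemma mclass_imset F F' : F \subset F' ->
  [set mclass F' y | y in Y] = [set \bigcup_(y in C) mclass F' y | C : {set Y} in [set mclass F y | y in Y]].
Proof.
by move=> sF; rewrite -imset_comp; apply: eq_imset => y; rewrite /= bigcup_mclass.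
Qed.

Lemma mcomp_le F F' : F \subset F' -> mcomp F' <= mcomp F.
Proof. by move=> sF; rewrite /mcomp (mclass_imset sF) leq_imset_card. Qed.

Lemma mcomp_lt F F' (y z : Y) : F \subset F' -> mclass F y != mclass F z ->
  mclass F' y = mclass F' z -> mcomp F' < mcomp F.
Proof.
move=> sF nyz eyz; rewrite ltn_neqAle mcomp_le // andbT /mcomp (mclass_imset sF).
apply: contra nyz => /imset_injP inj; apply/eqP/inj; rewrite ?imset_f //.
by rewrite !bigcup_mclass.
Qed.

Lemma mcomp_same F F' : F \subset F' ->
  (forall x, x \in F' -> mclass F (src x) = mclass F (tgt x)) -> mcomp F = mcomp F'.
Proof.
move=> sF H; congr #|pred_of_set _|; apply: eq_imset => y; apply/setP => z; rewrite !inE.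
apply/idP/idP; apply: connect_sub => a b.
  by move=> ab; apply/connect1/(sub_madj sF).
case/existsP => x /andP[/H Hx /orP[] /andP[/eqP <- /eqP <-]]; first exact/mclass_eqP.
by apply/mclass_eqP.
Qed.

Variable kap : nat.

Definition indep (conf : rel E) (A : {set E}) :=
  [forall x in A, forall y in A, (x != y) ==> ~~ conf x y].

Lemma indepP (conf : rel E) (A : {set E}) :
  reflect {in A &, forall x y, x != y -> ~~ conf x y} (indep conf A).
Proof.
apply: (iffP forall_inP) => [H x y xA yA xy|H x xA].
  by have /forall_inP/(_ y yA)/implyP := H x xA; apply.
by apply/forall_inP => y yA; apply/implyP; apply: H.
Qed.

Lemma indepS (conf : rel E) (A A' : {set E}) : A' \subset A -> indep conf A -> indep conf A'.
Proof.
by move=> sA /indepP H; apply/indepP => x y /(subsetP sA) xA /(subsetP sA) yA; apply: H.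
Qed.

Definition slice (b : bool) (s : {set E * bool}) : {set E} := [set x | (x, b) \in s].

Lemma slice_same b x s : slice b ((x, b) |: s) = x |: slice b s.
Proof. by apply/setP => y; rewrite !inE xpair_eqE eqxx andbT. Qed.

Lemma slice_diff b x s : slice b ((x, ~~ b) |: s) = slice b s.
Proof. by apply/setP => y; rewrite !inE xpair_eqE; case: b; rewrite andbF. Qed.

Lemma sliceS b (s t : {set E * bool}) : t \subset s -> slice b t \subset slice b s.
Proof. by move=> st; apply/subsetP => y; rewrite !inE; apply: (subsetP st). Qed.

(* The join of the independence complex of [conf] on [D] with the complex of the
   sets [A] of [B] such that [L] without [A] has at most [kap] components (on [B] the
   independent sets of the cographic matroid). *)
Definition cplx (conf : rel E) (D B L : {set E}) : pred {set E * bool} := fun s =>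
  [&& slice true s \subset D, indep conf (slice true s),
      slice false s \subset B & mcomp (L :\: slice false s) <= kap].

Lemma cplx_down conf D B L : downclosed (cplx conf D B L).
Proof.
move=> s t ts /and4P[h1 h2 h3 h4]; apply/and4P; split.
- exact: subset_trans (sliceS _ ts) h1.
- exact: indepS (sliceS _ ts) h2.
- exact: subset_trans (sliceS _ ts) h3.
- by apply: leq_trans h4; apply/mcomp_le/setDS/sliceS.
Qed.

(** The bound is the largest number of links of [B] that can be deleted: [mcomp (L :\: B) - kap] of
    them must be kept. For a link joining two components of [L :\: B], deletion and link in the
    complex are again of this form; the conflict factor is carried along. *)
Lemma conn_cographic (conf : rel E) (D B L : {set E}) : B \subset L -> mcomp L <= kap ->
  conn (cplx conf D B L) (#|B| - (mcomp (L :\: B) - kap)).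
Proof.
move En : #|B| => n; elim: n B L En => [|n IHn] B L En sBL cL; first by move=> d; rewrite sub0n.
have [small|big] := leqP (mcomp (L :\: B)) kap.
  have /card_gt0P[x xB] : 0 < #|B| by rewrite En.
  apply: (@conn_cone _ _ (x, false)); last exact: cplx_down.
  move=> s /and4P[h1 h2 h3 h4]; apply/and4P.
  rewrite (@slice_diff true) slice_same; split=> //; first by rewrite subUset sub1set xB.
  apply: leq_trans small; apply/mcomp_le/setDS.
  by rewrite subUset sub1set xB.
have /exists_inP[x xB nx] : [exists x in B, mclass (L :\: B) (src x) != mclass (L :\: B) (tgt x)].
  apply: contraTT big => /exists_inPn H; rewrite -leqNgt.
  rewrite (@mcomp_same (L :\: B) L) ?subsetDl // => x xL.
  have [xB|xB] := boolP (x \in B); first by apply/eqP; have := H x xB; rewrite negbK.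
  by apply: mclass_edge; rewrite inE xB.
have xL := subsetP sBL x xB.
have En' : #|B :\ x| = n by move: En; rewrite (cardsD1 x) xB => -[].
have sB'L : B :\ x \subset L by apply: subset_trans sBL; apply: subsetDl.
have LB : L :\: (B :\ x) = x |: (L :\: B).
  by apply/setP => y; rewrite !inE; case: (y =P x) => [->|] /=; rewrite ?xL ?eqxx.
have lt : mcomp (L :\: (B :\ x)) < mcomp (L :\: B).
  apply: mcomp_lt nx _; first by rewrite LB subsetUr.
  by apply: mclass_edge; rewrite LB setU11.
have le : n.+1 - (mcomp (L :\: B) - kap) <= n - (mcomp (L :\: (B :\ x)) - kap).
  by move: lt big; lia.
(* If removing [x] alone leaves too many components, [x] lies in no face. Dropping it from [B] keeps
   the complex, and [lt] makes up for the smaller [#|B|]. *)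
have [bridge|nbridge] := ltnP kap (mcomp (L :\ x)).
  apply: conn_le le _; apply: eq_conn (IHn _ _ En' sB'L cL) => s.
  apply/and4P/and4P => -[h1 h2 h3 h4]; split=> //; first exact: subset_trans h3 (subsetDl _ _).
  rewrite subsetD1 h3; apply/negP => xs; move: bridge; rewrite ltnNge => /negP; apply.
  by apply: leq_trans h4; apply/mcomp_le/setDS; rewrite sub1set.
apply: (@conn_vertex _ _ (x, false)); first exact: cplx_down.
  apply: conn_le le _; apply: eq_conn (IHn _ _ En' sB'L cL) => s.
  rewrite /del /cplx subsetD1 inE.
  by case: (_ \subset D); case: indep; case: (_ \subset B); case: (_ \in s); rewrite /= ?andbF.
have -> : (n.+1 - (mcomp (L :\: B) - kap)).-1 = n - (mcomp ((L :\ x) :\: (B :\ x)) - kap).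
  have -> : (L :\ x) :\: (B :\ x) = L :\: B.
    by apply/setP => y; rewrite !inE; case: (y =P x) => [->|] /=; rewrite ?xB ?eqxx ?andbT.
  by rewrite -subn1 -subnDA addnC subnDA subn1.
have sB'L' : B :\ x \subset L :\ x by apply: setSD.
apply: eq_conn (IHn _ _ En' sB'L' nbridge) => s.
rewrite /link /cplx (@slice_diff true) slice_same subsetD1 inE -setDDl.
rewrite subUset sub1set xB /=.
by case: (_ \subset D); case: indep; case: (_ \subset B); case: (_ \in s); rewrite /= ?andbF.
Qed.

(** Each unit of [m] gains one degree. A conflict between [x] in [I] and some [y] is erased by
    [conn_edge]: the inner induction, on the number of conflicts, treats the complex without it, and
    the outer one treats the link of the two vertices. Once [x] has no conflict left, the complex is
    a cone. *)
Lemma conn_dominate (B L : {set E}) m : B \subset L -> mcomp L <= kap ->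
  forall (conf : rel E) (D I : {set E}), symmetric conf -> I \subset D -> indep conf I ->
  (forall Z : {set E}, Z \subset D -> #|Z| < m ->
     exists2 v, v \in I & v \notin Z /\ forall z, z \in Z -> ~~ conf z v) ->
  conn (cplx conf D B L) (m + (#|B| - (mcomp (L :\: B) - kap))).
Proof.
move=> sBL cL; elim: m => [|m IHm] conf D I; first by move=> *; apply: conn_cographic.
move En : #|[set p | conf p.1 p.2]| => n.
elim/ltn_ind: n conf En => n IHn conf En sconf sID iI H.
have [|x xI _] := H set0 (sub0set _); first by rewrite cards0.
have xD := subsetP sID x xI.
have [/exists_inP[y yD /andP[xy cxy]]|/exists_inPn nc] :=
  boolP [exists y in D, (x != y) && conf x y]; last first.
  apply: (@conn_cone _ _ (x, true)); last exact: cplx_down.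
  move=> s /and4P[h1 h2 h3 h4]; apply/and4P.
  rewrite (@slice_diff false) slice_same; split=> //; first by rewrite subUset sub1set xD.
  apply/indepP => a b; rewrite !in_setU1 => /orP[/eqP ->|aS] /orP[/eqP ->|bS]; rewrite ?eqxx //.
  - by move=> ab; have := nc b (subsetP h1 b bS); rewrite ab.
  - by rewrite eq_sym sconf => ab; have := nc a (subsetP h1 a aS); rewrite ab.
  - exact: (indepP _ _ h2).
have yI : y \notin I by apply/negP => yI; have /indepP/(_ x y xI yI xy) := iI; rewrite cxy.
pose conf' u v := conf u v && ~~ (((u == x) && (v == y)) || ((u == y) && (v == x))).
have sconf' : symmetric conf'.
  by move=> u v; rewrite /conf' sconf orbC [(u == y) && _]andbC [(u == x) && _]andbC.
have sub' u v : conf' u v -> conf u v by case/andP.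
have iI' : indep conf' I.
  by apply/indepP => a b aI bI ab; apply: contra (sub' a b) (indepP _ _ iI a b aI bI ab).
pose D' := [set z in D | [&& z != x, z != y, ~~ conf' x z & ~~ conf' y z]].
apply: (@conn_edge _ _ (cplx conf' D B L) (x, true) (y, true)).
- by rewrite xpair_eqE negb_and xy.
- exact: cplx_down.
- move=> s; rewrite /cplx.
  suff -> : indep conf (slice true s) =
     indep conf' (slice true s) && ~~ (((x, true) \in s) && ((y, true) \in s)).
    by case: (_ \subset D); case: (indep _ _); case: (~~ _); rewrite /= ?andbT ?andbF.
  apply/indepP/andP => [iS|[/indepP iS nxy] a b aS bS ab].
    split; first by apply/indepP => a b aS bS ab; apply: contra (sub' a b) (iS a b aS bS ab).
    by apply/negP => /andP[xs ys]; have := iS x y; rewrite !inE cxy => /(_ xs ys xy).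
  have := iS a b aS bS ab; rewrite /conf' negb_and negbK => /orP[//|].
  by move: aS bS; rewrite !inE => aS bS /orP[] /andP[/eqP ea /eqP eb]; move: nxy; rewrite -ea -eb aS bS.
- apply: (IHn #|[set p | conf' p.1 p.2]|) => //.
    rewrite -En; apply: proper_card; apply/properP; split.
      by apply/subsetP => p; rewrite !inE => /sub'.
    by exists (x, y); rewrite !inE // /conf' !eqxx /= andbF.
  move=> Z ZD cZ; have [v vI [vZ hv]] := H Z ZD cZ; exists v => //; split=> // z zZ.
  exact: contra (@sub' z v) (hv z zZ).
rewrite addSn /=.
have : conn (cplx conf' D' B L) (m + (#|B| - (mcomp (L :\: B) - kap))).
  apply: (IHm _ _ (I :&: D')) => //; first exact: subsetIr.
    exact: indepS (subsetIl _ _) iI'.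
  move=> Z ZD' cZ.
  (* Adding [y] to [Z] uses up one unit of [m]. The surviving [v] does not conflict with [y], hence
     differs from [x], and independence of [I] then puts it in [D']. *)
  have [| |v vI [vZ hv]] := H (y |: Z).
  - rewrite subUset sub1set yD; apply: subset_trans ZD' _.
    by apply/subsetP => z; rewrite inE => /andP[].
  - by rewrite cardsU1; case: (y \notin Z) => //=; rewrite ?add1n // add0n ltnW.
  move: vZ; rewrite in_setU1 negb_or => /andP[vy vZ].
  have cyv : ~~ conf y v by apply: hv; rewrite setU11.
  have vx : v != x by apply: contraNneq cyv => ->; rewrite sconf.
  exists v.
    rewrite inE vI inE (subsetP sID v vI) vx vy /=.
    rewrite (contra (@sub' y v) cyv) andbT.
    by have /indepP := iI'; apply=> //; rewrite eq_sym.
  split=> // z zZ; apply: contra (@sub' z v) _; apply: hv.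
  by rewrite in_setU1 zZ orbT.
apply: eq_conn => s.
rewrite /link /cplx !(@slice_diff false) !slice_same !in_setU1 xpair_eqE andbT [y == x]eq_sym (negPf xy) /=.
rewrite andbA; have -> : (slice true s \subset D') && indep conf' (slice true s) =
  [&& (x, true) \notin s, (y, true) \notin s, (y |: (x |: slice true s)) \subset D &
    indep conf' (y |: (x |: slice true s))].
  apply/andP/and4P => [[sD iS]|[xs ys sD iS]].
    have hD z : (z, true) \in s -> z \in D' by move=> zs; apply: (subsetP sD); rewrite inE.
    split.
    - by apply/negP => /hD; rewrite !inE eqxx andbF.
    - by apply/negP => /hD; rewrite !inE eqxx !andbF.
    - rewrite !subUset !sub1set yD xD; apply: subset_trans sD _.
      by apply/subsetP => z; rewrite inE => /andP[].
    have nxy : ~~ conf' x y by rewrite /conf' !eqxx /= andbF.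
    apply/indepP => a b; rewrite !in_setU1 => /or3P[/eqP ->|/eqP ->|aS] /or3P[/eqP ->|/eqP ->|bS];
      rewrite ?eqxx // ?[conf' y x]sconf' //.
    - by move: bS; rewrite inE => /hD; rewrite inE => /andP[_ /and4P[]].
    - by move: bS; rewrite inE => /hD; rewrite inE => /andP[_ /and4P[]].
    - by rewrite sconf'; move: aS; rewrite inE => /hD; rewrite inE => /andP[_ /and4P[]].
    - by rewrite sconf'; move: aS; rewrite inE => /hD; rewrite inE => /andP[_ /and4P[]].
    - exact: (indepP _ _ iS).
  split; last by apply: indepS iS; rewrite setUA subsetUr.
  apply/subsetP => z zS; rewrite inE (subsetP sD) ?in_setU1 ?zS ?orbT //=.
  have zx : z != x by apply: contraNneq xs => <-; rewrite inE in zS.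
  have zy : z != y by apply: contraNneq ys => <-; rewrite inE in zS.
  rewrite zx zy /=; apply/andP; split; apply: (indepP _ _ iS);
    by rewrite ?in_setU1 ?zS ?eqxx ?orbT // eq_sym.
by case: (_ \in s) => //=; case: (_ \in s); case: (_ \subset D); case: indep; rewrite /= ?andbT ?andbF.
Qed.



(** * A topological Hall theorem by a Sperner argument *)

Section Transversal.
Local Open Scope ring_scope.

Notation chain := {ffun {set E * bool} -> 'F_2}.

Definition transv (B : {set E}) (s : {set E * bool}) :=
  ([set v.1 | v in s] == B) && (#|s| == #|B|).

Lemma transv_dup B s v w : transv B s -> v \in s -> w \in s -> v.1 = w.1 -> v = w.
Proof.
case/andP => /eqP im cs; have : #|[set v.1 | v in s]| == #|s| by rewrite im eq_sym.
by move/imset_injP; apply.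
Qed.

(** Door counting as in Sperner's lemma. Let [s :\ w] be a transversal of [B :\ b]. If [w] has label
    [b], then [s] is a transversal of [B] and [w] is the only such element; otherwise [w] repeats
    the label of one other [v], and exactly [w] and [v] count, cancelling each other. *)
Lemma transv_parity (B : {set E}) b (s : {set E * bool}) : b \in B -> #|s| = #|B| ->
  (forall v, v \in s -> v.1 \in B) ->
  \sum_(w in s) (transv (B :\ b) (s :\ w))%:R = (transv B s)%:R :> 'F_2.
Proof.
move=> bB cs sB.
have cD w : w \in s -> #|s :\ w| == #|B :\ b|.
  by move=> ws; move: cs; rewrite (cardsD1 w) ws (cardsD1 b B) bB => /addnI ->.
have [/exists_inP[w ws tw]|/exists_inPn H] :=
  boolP [exists w in s, transv (B :\ b) (s :\ w)]; last first.
  rewrite big1 => [|w ws]; last by rewrite (negPf (H w ws)).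
  case: (boolP (transv B s)) => // tB.
  have : b \in [set v.1 | v in s] by case/andP: tB => /eqP ->.
  case/imsetP => w ws bw; case/negP: (H w ws); apply/andP; split; last exact: cD.
  case/andP: (tB) => /eqP im _; apply/eqP/setP => x; rewrite -im bw.
  apply/imsetP/idP => [[v /setD1P[vw vs] ->]|/setD1P[xw /imsetP[v vs xv]]].
    by rewrite !inE imset_f // andbT; apply: contra vw => /eqP/(transv_dup tB vs ws) ->.
  by exists v => //; rewrite !inE vs andbT; apply: contraNneq xw => <-; rewrite xv.
case/andP: (tw) => /eqP imw _.
have ims : [set v.1 | v in s] = w.1 |: (B :\ b) by rewrite -{1}(setD1K ws) imsetU1 imw.
rewrite (bigD1 w) //= tw.
have [wb|wb] := eqVneq w.1 b.
  have -> : transv B s by rewrite /transv ims wb setD1K // cs !eqxx.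
  rewrite big1 ?addr0 // => v /andP[vs vw].
  suff -> : transv (B :\ b) (s :\ v) = false by [].
  apply/negP => /andP[/eqP im _]; have : b \in B :\ b; last by rewrite setD11.
  by rewrite -im -wb; apply: imset_f; rewrite !inE ws eq_sym vw.
have wB : w.1 \in B :\ b by rewrite !inE wb sB.
have -> : transv B s = false.
  apply/negP => /andP[/eqP im _]; move: bB; rewrite -im ims !inE eqxx /= orbF.
  by rewrite eq_sym (negPf wb).
have /imsetP[v /setD1P[vw vs] wv] : w.1 \in [set v.1 | v in s :\ w] by rewrite imw.
rewrite (bigD1 v) /=; last by rewrite vs.
have -> : transv (B :\ b) (s :\ v).
  rewrite /transv cD // andbT; apply/eqP; rewrite -imw; apply/setP => x.
  apply/imsetP/imsetP => -[u /setD1P[uv us] ->].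
    have [uw|uw] := eqVneq u w; last by exists u; rewrite // !inE uw.
    by exists v; rewrite ?uw // !inE vw.
  have [uw|uw] := eqVneq u v; last by exists u; rewrite // !inE uw.
  by exists w; rewrite ?uw // !inE ws eq_sym vw.
rewrite big1 ?addr0 ?addF2 // => u /andP[/andP[us uw] uv].
suff -> : transv (B :\ b) (s :\ u) = false by [].
apply/negP => tu; case/eqP: vw; apply: (transv_dup tu); rewrite ?wv // !inE.
  by rewrite vs eq_sym uv.
by rewrite ws eq_sym uw.
Qed.

Variables (KB : {set E} -> pred {set E * bool}).
Hypothesis KB0 : KB set0 set0.
Hypothesis KB_fst : forall B s v, KB B s -> v \in s -> v.1 \in B.
Hypothesis KB_mono : forall (B B' : {set E}) s, B \subset B' -> KB B s -> KB B' s.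
Hypothesis KB_acyc : forall B : {set E}, B != set0 -> acyc (KB B) #|B|.-1.

Lemma chain_system n : exists c : {set E} -> chain,
  c set0 = [ffun s => (s == set0)%:R] /\
  forall B : {set E}, (#|B| <= n)%N ->
    supported (KB B) #|B| (c B) /\ bnd (c B) = \sum_(b in B) c (B :\ b).
Proof.
elim: n => [|n [c [c0 Hc]]].
  exists (fun _ => [ffun s => (s == set0)%:R]); split=> // B; rewrite leqn0 cards_eq0 => /eqP ->.
  split=> [s|]; first by rewrite ffunE; have [-> _|_] := eqVneq s set0; rewrite ?cards0 ?mulr0n ?eqxx.
  rewrite big_set0; apply/ffunP => t; rewrite !ffunE big1 // => v _.
  have /negPf vt0 : v |: t != set0 by apply/set0Pn; exists v; rewrite setU11.
  by rewrite ffunE vt0.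
have [c' Hc'] : exists c' : {set E} -> chain, forall B : {set E}, #|B| = n.+1 ->
    supported (KB B) #|B| (c' B) /\ bnd (c' B) = \sum_(b in B) c (B :\ b).
  apply: (fin_all_exists (P := fun (B : {set E}) (w : chain) => #|B| = n.+1 -> supported (KB B) #|B| w /\
    bnd w = \sum_(b in B) c (B :\ b))) => B.
  have [cB|cB] := eqVneq #|B| n.+1; last by exists 0 => /eqP; rewrite (negPf cB).
  have cD b : b \in B -> #|B :\ b| = n by move=> bB; move: cB; rewrite (cardsD1 b) bB => -[].
  have Bn0 : B != set0 by rewrite -card_gt0 cB.
  have [||w sw bw] := KB_acyc Bn0 (z := \sum_(b in B) c (B :\ b)).
  - apply: supp_sum => b bB s nz.
    have [|sc _] := Hc (B :\ b); first by rewrite cD.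
    have [Ks cs] := sc s nz; split; first exact: KB_mono (subsetDl _ _) Ks.
    by rewrite cs cD // cB.
  - rewrite bnd_sum; apply/ffunP => t.
    rewrite (eq_bigr (fun b => \sum_(b' in B :\ b) c (B :\ b :\ b'))); last first.
      by move=> b bB; have [|_ ->] := Hc (B :\ b); rewrite ?cD.
    rewrite sum_ffunE ffunE.
    rewrite -[RHS](@sum_sym_F2 _ (fun b => b \in B) (fun b b' => c (B :\ b :\ b') t)).
      apply: eq_bigr => b bB; rewrite sum_ffunE; apply: eq_bigl => b'.
      by rewrite in_setD1 andbC.
    by move=> b b'; congr (c _ t); apply/setP => x; rewrite !inE andbCA.
  by exists w => _; move: sw; rewrite cB.
exists (fun B : {set E} => if (#|B| <= n)%N then c B else c' B); split; first by rewrite cards0.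
move=> B cB.
have [Bn|nB] := leqP #|B| n.
  have [sc ->] := Hc B Bn; split=> //; apply: eq_bigr => b bB.
  by rewrite (leq_trans _ Bn) // subset_leq_card // subsetDl.
have [|sc ->] := Hc' B; first by apply/eqP; rewrite eqn_leq cB nB.
split=> //; apply: eq_bigr => b bB; case: ifP => // /negP[].
by move: cB; rewrite (cardsD1 b) bB.
Qed.

(* The chain of [B] contains an odd number of transversals of [B]: this is Sperner's lemma
   for the system of chains above. *)
Lemma transversal_exists : exists2 s, KB setT s & forall x, ((x, true) \in s) (+) ((x, false) \in s).
Proof.
have [c [c0 Hc]] := chain_system #|E|.
have odd n (B : {set E}) : #|B| = n -> \sum_(s | transv B s) c B s = 1.
  elim: n B => [|n IHn] B cB.
    have -> : B = set0 by apply/eqP; rewrite -cards_eq0 cB.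
    rewrite (bigD1 set0) /=; last by rewrite /transv imset0 !cards0 !eqxx.
    rewrite big1 ?addr0; first by rewrite c0 ffunE eqxx.
    move=> s /andP[/andP[_]]; rewrite cards0 cards_eq0 => /eqP -> .
    by rewrite eqxx.
  have /card_gt0P[b bB] : (0 < #|B|)%N by rewrite cB.
  have cD b' : b' \in B -> #|B :\ b'| = n by move=> b'B; move: cB; rewrite (cardsD1 b') b'B => -[].
  have [sc bc] := Hc B (max_card _).
  rewrite -(IHn (B :\ b) (cD b bB)).
  (* Of the summands of the boundary only [c (B :\ b)] can charge a transversal of [B :\ b]: faces
     of [KB (B :\ b')] never use the label [b']. *)
  have -> : \sum_(t | transv (B :\ b) t) c (B :\ b) t = \sum_(t | transv (B :\ b) t) bnd (c B) t.
    apply: eq_bigr => t tt; rewrite bc sum_ffunE (bigD1 b) //= big1 ?addr0 // => b' /andP[b'B b'b].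
    have [scD _] := Hc (B :\ b') (max_card _); apply: (supp_out scD).
    apply/negP => Kt; case/andP: tt => /eqP im _.
    have : b' \in [set v.1 | v in t] by rewrite im !inE b'b.
    by case/imsetP => v vt bv; have := KB_fst Kt vt; rewrite -bv setD11.
  have -> : \sum_(t | transv (B :\ b) t) bnd (c B) t =
            \sum_(s : {set E * bool}) \sum_(w in s) (transv (B :\ b) (s :\ w))%:R * c B s.
    rewrite big_mkcond.
    under eq_bigr => t _ do rewrite -[if _ then _ else _]/(if transv (B :\ b) t then _ else 0) ffunE.
    transitivity (\sum_(t : {set E * bool}) \sum_(w | w \notin t) (transv (B :\ b) t)%:R * c B (w |: t)).
      apply: eq_bigr => t _; case: ifP => tt; last by rewrite big1 // => w _; rewrite mul0r.
      by apply: eq_bigr => w _; rewrite mul1r.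
    rewrite (exchange_big_dep xpredT) //= [RHS](exchange_big_dep xpredT) //=.
    apply: eq_bigr => w _.
    rewrite (reindex_onto (fun s => s :\ w) (fun t => w |: t)) /=; last first.
      by move=> t wt; rewrite setU1K.
    apply: eq_big => [s|s /andP[ws /eqP <-]]; last by rewrite setU1K // setD11.
    rewrite setD11 /=; apply/eqP/idP => [<-|ws]; first by rewrite setU11.
    by rewrite setD1K.
  rewrite [LHS]big_mkcond; apply: eq_bigr => s _.
  rewrite -mulr_suml; have [->|nz] := eqVneq (c B s) 0; first by rewrite mulr0 if_same.
  have [Ks cs] := sc s nz.
  rewrite transv_parity //; last by move=> v; apply: KB_fst.
  by case: ifP => _; rewrite ?mul1r ?mul0r.
have /existsP[s /andP[ts nz]] : [exists s, transv setT s && (c setT s != 0)].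
  apply: contraT => /existsPn H; have := odd _ [set: E] (erefl _).
  by rewrite big1 // => s ts; have := H s; rewrite ts negbK => /eqP.
have [sc _] := Hc setT (max_card _); have [Ks cs] := sc s nz.
exists s => // x; case/andP: (ts) => /eqP im _.
have : x \in [set v.1 | v in s] by rewrite im.
case/imsetP => -[y b] vs /= xy; rewrite xy.
have H b' : (y, b') \in s -> b' = b by move=> ys; have := transv_dup ts ys vs (erefl _) => -[].
case: b vs H {im} => vs H; rewrite vs; case: (boolP (_ \in s)) => //.
  by move/H.
by move/H.
Qed.

End Transversal.

(** For a set [B] of links the cographic factor falls short of degree [#|B|] by the excess of
    [mcomp (~: B)] over [kap]; the hypothesis at [F = ~: B] supplies exactly this through
    [conn_dominate]. In the resulting transversal the deleted links are the complement of the kept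
    ones. *)
Theorem conflict_free_connected (conf : rel E) : symmetric conf -> mcomp setT <= kap ->
  (forall F, kap < mcomp F -> exists I : {set E},
     [/\ I \subset ~: F, indep conf I &
      forall Z : {set E}, Z \subset ~: F -> #|Z| < mcomp F - kap ->
        exists2 v, v \in I & v \notin Z /\ forall z, z \in Z -> ~~ conf z v]) ->
  exists2 R : {set E}, indep conf R & mcomp R <= kap.
Proof.
move=> sconf cT H.
have [|B s v|B B' s sB|B Bn0|s] := @transversal_exists (fun B => cplx conf B B setT).
- have e0 b : slice b set0 = set0 by apply/setP => x; rewrite !inE.
  rewrite /cplx !e0 !sub0set setD0 cT /= andbT.
  by apply/indepP => x y; rewrite inE.
- move=> /and4P[h1 _ h2 _]; case: v => x [] xs; first by apply: (subsetP h1); rewrite inE.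
  by apply: (subsetP h2); rewrite inE.
- by move=> /and4P[h1 h2 h3 h4]; apply/and4P; split=> //; apply: subset_trans sB.
- have [/H[I [sI iI HI]]|small] := ltnP kap (mcomp (~: B)).
    have : conn (cplx conf B B setT) ((mcomp (~: B) - kap) + (#|B| - (mcomp (setT :\: B) - kap))).
      rewrite setCK in sI HI; exact: (conn_dominate (subsetT B) cT sconf sI iI HI).
    apply; rewrite setTD.
    by have : 0 < #|B|; [rewrite card_gt0 | lia].
  apply: (@conn_cographic conf B B setT (subsetT B) cT); rewrite setTD.
  by have : 0 < #|B|; [rewrite card_gt0 | lia].
case/and4P => _ h2 _ h4 Hs; exists (slice true s) => //.
suff -> : slice true s = setT :\: slice false s by [].
by apply/setP => x; rewrite !inE andbT; have := Hs x; case: (_ \in s); case: (_ \in s).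
Qed.

End Multigraph.

(** * Hall's theorem and the Tutte-Berge formula *)

Section Hall.
Variables (I J : finType) (r : I -> J -> bool).

Definition nbh (A : {set I}) (D : {set J}) : {set J} := [set j in D | [exists i in A, r i j]].

(** Halmos-Vaughan induction: either some proper nonempty subset is tight, and it and its complement
    are matched separately, or there is slack everywhere and any single pair can be matched and
    removed. *)
Lemma hall_system (A : {set I}) (D : {set J}) :
  (forall B : {set I}, B \subset A -> #|B| <= #|nbh B D|) ->
  exists2 f : I -> option J, {in A, forall i, exists2 j, f i = Some j & (j \in D) && r i j} &
     {in A &, injective f}.
Proof.
move En : #|A| => n; elim/ltn_ind: n A D En => n IHn A D En HA.
have [A0|[i iA]] := set_0Vmem A.
  by exists (fun _ => None) => [i|i i']; rewrite A0 inE.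
have [/existsP[B /and4P[sBA nB0 nBA tB]]|/existsPn noT] :=
  boolP [exists B : {set I}, [&& B \subset A, B != set0, B != A & #|nbh B D| <= #|B|]].
  have prB : B \proper A by rewrite properEneq nBA.
  have [||f fB injB] := IHn #|B| _ B D (erefl _).
  - by rewrite -En; apply: proper_card.
  - by move=> B' sB'; apply: HA; apply: subset_trans sB' sBA.
  have [|C sC|g gA injA] := IHn #|A :\: B| _ (A :\: B) (D :\: nbh B D) (erefl _).
  - rewrite -En; apply: proper_card; apply/properP; split; first exact: subsetDl.
    by case/set0Pn: nB0 => b bB; exists b; rewrite ?(subsetP sBA) // inE bB.
  - have dCB : [disjoint C & B] by rewrite disjoints_subset (subset_trans sC) // setDE subsetIr.
    have := HA (C :|: B); rewrite subUset sBA (subset_trans sC (subsetDl _ _)) => /(_ isT).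
    have -> : #|C :|: B| = #|C| + #|B| by rewrite cardsU disjoint_setI0 // cards0 subn0.
    have sub : nbh (C :|: B) D \subset nbh C (D :\: nbh B D) :|: nbh B D.
      apply/subsetP => j; rewrite !inE => /andP[jD /exists_inP[k]].
      rewrite jD /= andbT inE => /orP[kC|kB] rkj; last first.
        by apply/orP; right; apply/exists_inP; exists k.
      case: (boolP [exists i in B, r i j]) => //= _; rewrite orbF.
      by apply/exists_inP; exists k.
    have := leq_trans (subset_leq_card sub) (leq_card_setU _ _).
    by move: tB; lia.
  exists (fun x => if x \in B then f x else g x).
    move=> x xA; case: ifP => xB; first exact: fB.
    by have [|j gj /andP[]] := gA x; rewrite ?inE ?xB // => /andP[_ jD] rj; exists j; rewrite ?jD.
  have nfg x y : x \in B -> y \in A -> y \notin B -> f x = g y -> False.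
    move=> xB yA yB; have [j -> /andP[jD rxj]] := fB x xB.
    have [|k -> /andP[]] := gA y; first by rewrite inE yB.
    rewrite !inE => /andP[nk _] _ [jk]; case/negP: nk; rewrite -jk jD /=.
    by apply/exists_inP; exists x.
  move=> x y xA yA; case: ifP => xB; case: ifP => yB.
  - exact: injB.
  - by move=> /(nfg x y xB yA); rewrite yB => /(_ isT).
  - by move=> /esym/(nfg y x yB xA); rewrite xB => /(_ isT).
  - by apply: injA; rewrite inE ?xB ?yB.
have sur (B : {set I}) : B \subset A -> B != set0 -> B != A -> #|B| < #|nbh B D|.
  by move=> h1 h2 h3; have := noT B; rewrite h1 h2 h3 /= -ltnNge.
have /card_gt0P[j] : 0 < #|nbh [set i] D|.
  by apply: leq_trans (HA [set i] _); rewrite ?cards1 // sub1set.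
rewrite inE => /andP[jD /exists_inP[i' /set1P ->] rij].
have [|C sC|g gA injA] := IHn #|A :\ i| _ (A :\ i) (D :\ j) (erefl _).
- by rewrite -En; apply: proper_card; apply: properD1.
- have [->|C0] := eqVneq C set0; first by rewrite cards0.
  have CA : C \subset A by apply: subset_trans sC (subsetDl _ _).
  have nCA : C != A by apply: contraTneq sC => ->; apply/negP => /subsetP/(_ i iA); rewrite setD11.
  have := sur C CA C0 nCA.
  have sub : nbh C D \subset j |: nbh C (D :\ j).
    apply/subsetP => k; rewrite !inE => /andP[-> ->]; rewrite !andbT.
    by case: (k =P j).
  have := leq_trans (subset_leq_card sub) (leq_card_setU _ _).
  by rewrite cards1; lia.
exists (fun x => if x == i then Some j else g x).
  move=> x xA; case: eqP => [->|/eqP xi]; first by exists j; rewrite ?jD.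
  by have [|k gk /andP[]] := gA x; rewrite ?inE ?xi // => /andP[_ kD] rk; exists k; rewrite ?kD.
have ng x : x \in A -> x != i -> g x <> Some j.
  move=> xA xi; have [|k -> /andP[]] := gA x; first by rewrite !inE xi.
  by rewrite !inE => /andP[kj _] _ [kj']; rewrite kj' eqxx in kj.
move=> x y xA yA; case: eqP => [->|/eqP xi]; case: eqP => [->|/eqP yi] //.
- by move/esym/(ng y yA yi).
- by move/(ng x xA xi).
- by apply: injA; rewrite !inE ?xi ?yi.
Qed.

(** [B] maximizes [#|B| - #|nbh B setT|]. A subset of [A :\: B] violating Hall's condition outside
    the neighbourhood of [B] could be joined to [B] and would raise this maximum. *)
Lemma hall_deficiency (A : {set I}) : exists (B : {set I}) (f : I -> option J),
  [/\ B \subset A, #|nbh B setT| <= #|B|,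
      {in A :\: B, forall i, exists2 j, f i = Some j & (j \notin nbh B setT) && r i j} &
      {in A :\: B &, injective f}].
Proof.
have ex0 : exists n, [exists B : {set I}, (B \subset A) && (#|B| == #|nbh B setT| + n)].
  exists 0; apply/existsP; exists set0; rewrite sub0set cards0 addn0 eq_sym cards_eq0.
  by apply/eqP/setP => j; rewrite !inE; apply/exists_inP => -[i]; rewrite inE.
have ub n : [exists B : {set I}, (B \subset A) && (#|B| == #|nbh B setT| + n)] -> n <= #|I|.
  move=> /existsP[B /andP[_ /eqP EB]]; apply: leq_trans (max_card B).
  by rewrite EB; exact: leq_addl.
case: (ex_maxnP ex0 ub) => n /existsP[B /andP[sBA /eqP EB]] maxB.
exists B; have [C sC|f fB injB] := @hall_system (A :\: B) (~: nbh B setT).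
- have [//|lt] := leqP #|C| #|nbh C (~: nbh B setT)|.
  have dCB : [disjoint C & B] by rewrite disjoints_subset (subset_trans sC) // setDE subsetIr.
  have cU : #|C :|: B| = #|C| + #|B| by rewrite cardsU disjoint_setI0 // cards0 subn0.
  have sub : nbh (C :|: B) setT \subset nbh C (~: nbh B setT) :|: nbh B setT.
    apply/subsetP => j; rewrite !inE /= => /exists_inP[k].
    rewrite inE => /orP[kC|kB] rkj; last first.
      by apply/orP; right; apply/exists_inP; exists k.
    case: (boolP [exists i in B, r i j]) => /= _; rewrite ?orbT // orbF.
    by apply/exists_inP; exists k.
  have le := leq_trans (subset_leq_card sub) (leq_card_setU _ _).
  have := maxB (#|C :|: B| - #|nbh (C :|: B) setT|); rewrite (_ : [exists B, _]); first by lia.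
  apply/existsP; exists (C :|: B); rewrite subUset sBA (subset_trans sC (subsetDl _ _)) /=.
  by apply/eqP; lia.
exists f; split=> //; first by rewrite EB leq_addr.
by move=> i /fB [j fj]; rewrite inE; exists j.
Qed.

End Hall.

(** * Maximum matchings, Gallai's lemma and the Tutte-Berge formula *)

Section Matching.
Variables (T : finType) (g : rel T).
Hypothesis gsym : symmetric g.
Implicit Types (U : {set T}) (m : {ffun T -> T}).

(** An involution whose fixed points are the unmatched vertices; exchanging two matchings on a set
    is then a pointwise [if]. *)
Definition matching (U : {set T}) (m : {ffun T -> T}) :=
  [forall x, (m (m x) == x) && ((m x != x) ==> [&& g x (m x), x \in U & m x \in U])].
Definition covered (m : {ffun T -> T}) : {set T} := [set x | m x != x].

Lemma matchingP U m :
  reflect (involutive m /\ forall x, m x != x -> [/\ g x (m x), x \in U & m x \in U]) (matching U m).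
Proof.
apply: (iffP forallP) => [H|[mI H] x].
  split=> x; first by have /andP[/eqP] := H x.
  by move=> mx; have /andP[_ /implyP/(_ mx)/and3P] := H x.
by rewrite mI eqxx; apply/implyP => /H/and3P.
Qed.

Definition lowers (m : {ffun T -> T}) : {set T} := [set x | enum_rank x < enum_rank (m x)].

Lemma covered_double U m : matching U m -> #|covered m| = (#|lowers m|).*2.
Proof.
case/matchingP => mI _; have mi := inv_inj mI.
have -> : covered m = lowers m :|: (m @: lowers m).
  apply/setP => x; rewrite !inE.
  have -> : (x \in m @: lowers m) = (enum_rank (m x) < enum_rank x).
    by rewrite -{1}(mI x) mem_imset // inE mI.
  by rewrite -neq_ltn (inj_eq val_inj) (inj_eq enum_rank_inj) eq_sym.
rewrite cardsU (card_imset _ mi) -addnn.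
suff -> : lowers m :&: m @: lowers m = set0 by rewrite cards0 subn0.
apply/setP => x; rewrite !inE.
have -> : (x \in m @: lowers m) = (enum_rank (m x) < enum_rank x).
  by rewrite -{1}(mI x) mem_imset // inE mI.
by apply/negP => /andP[a b]; have := ltn_trans a b; rewrite ltnn.
Qed.

Lemma matching_id U : matching U [ffun x => x].
Proof. by apply/matchingP; split=> x; rewrite !ffunE ?eqxx. Qed.

Definition maxcov U := \max_(m | matching U m) #|covered m|.

Lemma maxcovP U : exists2 m, matching U m & #|covered m| = maxcov U.
Proof.
have gt0 : 0 < #|[pred m | matching U m]|.
  by apply/card_gt0P; exists [ffun x => x]; apply: matching_id.
by have [m mm E] := eq_bigmax_cond (fun m => #|covered m|) gt0; exists m.
Qed.

Lemma leq_maxcov U m : matching U m -> #|covered m| <= maxcov U.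
Proof. by move=> mm; apply: (@leq_bigmax_cond _ (matching U) (fun m => #|covered m|)). Qed.

Lemma matchingS U U' m : U \subset U' -> matching U m -> matching U' m.
Proof.
move=> sU /matchingP[mI H]; apply/matchingP; split=> // x /H[gx xU mU].
by split=> //; apply: (subsetP sU).
Qed.

Lemma matching_swap U m1 m2 (O : {set T}) : matching U m1 -> matching U m2 ->
  (forall x, (m1 x \in O) = (x \in O)) -> (forall x, (m2 x \in O) = (x \in O)) ->
  matching U [ffun x => if x \in O then m2 x else m1 x].
Proof.
move=> /matchingP[I1 H1] /matchingP[I2 H2] O1 O2; apply/matchingP; split=> x; rewrite !ffunE.
  by case xO : (x \in O); rewrite ?O1 ?O2 xO ?I1 ?I2.
by case: ifP => _; [apply: H2 | apply: H1].
Qed.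

(** The two exchanged matchings together cover as many vertices as [m1] and [m2], and neither
    exceeds the maximum. *)
Lemma cov_swap U m1 m2 (O : {set T}) : matching U m1 -> matching U m2 ->
  (forall x, (m1 x \in O) = (x \in O)) -> (forall x, (m2 x \in O) = (x \in O)) ->
  #|covered m1| = maxcov U -> #|covered m2| = maxcov U ->
  #|covered [ffun x => if x \in O then m2 x else m1 x]| = maxcov U.
Proof.
move=> M1 M2 O1 O2 c1 c2.
have l1 := leq_maxcov (matching_swap M1 M2 O1 O2).
have l2 := leq_maxcov (matching_swap M2 M1 O2 O1).
have cE m m' : covered [ffun x => if x \in O then m' x else m x] =
    (covered m' :&: O) :|: (covered m :\: O).
  apply/setP => x; rewrite !inE ffunE; case: (x \in O); rewrite ?andbT ?andbF ?orbF //.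
have cc m m' : #|covered [ffun x => if x \in O then m' x else m x]| =
    #|covered m' :&: O| + #|covered m :\: O|.
  rewrite cE cardsU (_ : _ :&: _ :&: _ = set0) ?cards0 ?subn0 //.
  by apply/setP => x; rewrite !inE; case: (x \in O); rewrite ?andbF.
move: l1 l2; rewrite !cc; move: (cardsID O (covered m1)) (cardsID O (covered m2)).
by rewrite c1 c2; lia.
Qed.

Section Alternating.
Variables (m1 m2 : T -> T) (v : T).
Hypotheses (I1 : involutive m1) (I2 : involutive m2) (v2 : m2 v = v).

Fixpoint alt k : T := if k is k'.+1 then (if odd k' then m2 else m1) (alt k') else v.

Definition arel : rel T := [rel x y | (y == m1 x) || (y == m2 x)].
Definition orb : {set T} := [set y | connect arel v y].

Lemma arel_sym : connect_sym arel.
Proof.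
apply: sym_connect_sym => x y.
by rewrite /arel /= -(can2_eq I1 I1) -(can2_eq I2 I2) ![_ == x]eq_sym.
Qed.

Lemma orb_stable1 x : (m1 x \in orb) = (x \in orb).
Proof. by rewrite !inE; apply/esym/same_connect_r; [exact: arel_sym | apply: connect1; rewrite /arel /= eqxx]. Qed.

Lemma orb_stable2 x : (m2 x \in orb) = (x \in orb).
Proof. by rewrite !inE; apply/esym/same_connect_r; [exact: arel_sym | apply: connect1; rewrite /arel /= eqxx orbT]. Qed.

Lemma orb_closed (P : T -> Prop) :
  P v -> (forall x, P x -> P (m1 x) /\ P (m2 x)) -> forall x, x \in orb -> P x.
Proof.
move=> Pv HP x; rewrite inE => /connectP[p pp ->].
elim: p v Pv pp => //= y p IHp u Pu /andP[uy pp]; apply: IHp pp.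
by have [h1 h2] := HP u Pu; case/orP: uy => /eqP ->.
Qed.

Lemma alt_prev k : (if odd k then m2 else m1) (alt k.+1) = alt k.
Proof. by rewrite /=; case: odd; rewrite ?I1 ?I2. Qed.

Lemma orb_alt x : x \in orb -> exists k, x = alt k.
Proof.
move: x; apply: orb_closed; first by exists 0.
move=> x [k ->]; split.
  case ok : (odd k); last by exists k.+1; rewrite /= ok.
  by case: k ok => // k /= ok; exists k; rewrite -{2}(alt_prev k) /= (negPf ok).
case ok : (odd k); first by exists k.+1; rewrite /= ok.
case: k ok => [|k] ok; first by exists 0; rewrite /= v2.
by exists k; move: ok => /= /negbFE ok; rewrite -{2}(alt_prev k) /= ok.
Qed.

(* The alternating path from [v] has only one other end. *)
Lemma orb_end_uniq u w : u \in orb -> w \in orb -> m1 u = u -> m1 w = w -> u = w.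
Proof.
move=> uO wO u1 w1.
(* At the first index [i] where [m1] fixes the path, the path turns back, so the indices up to [i]
   exhaust the orbit. *)
have ex : exists k, m1 (alt k) == alt k.
  by have [k Ek] := orb_alt uO; exists k; rewrite -Ek u1.
case: (ex_minnP ex) => i /eqP fi mini.
have inO x : x \in orb -> exists2 k, k <= i & x = alt k.
  move: x; apply: orb_closed; first by exists 0.
  move=> x [k ki ->]; split.
    case ok : (odd k).
      case: k ok ki => // k /= ok ki; exists k; first exact: ltnW.
      by rewrite -{2}(alt_prev k) /= (negPf ok).
    have [ki'|] := ltnP k i; first by exists k.+1; rewrite //= ok.
    by move=> ik; have -> : k = i; [lia | exists i].
  case ok : (odd k).
    have [ki'|ik] := ltnP k i; first by exists k.+1; rewrite //= ok.
    have Eki : k = i by lia.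
    case: k ok ki ik Eki => // k /= ok ki ik Eki.
    suff : i <= k by lia.
    apply: mini; apply/eqP; move: fi; rewrite -Eki /= (negPf ok) I1 => Ek.
    by rewrite -Ek.
  case: k ok ki => [|k] ok ki; first by exists 0; rewrite //= v2.
  exists k; first exact: ltnW.
  by move: ok => /= /negbFE ok; rewrite -{2}(alt_prev k) /= ok.
have fin x : x \in orb -> m1 x = x -> x = alt i.
  move=> /inO[k ki ->] fk; have : i <= k by apply: mini; rewrite fk.
  by move=> ik; congr alt; lia.
by rewrite (fin u) // (fin w).
Qed.

End Alternating.

(** Gallai's lemma: call two vertices apart if they are equal or no maximum matching misses both.
    Adjacent vertices are apart, and the relation is transitive since each vertex of [U] is missed
    by some maximum matching. *)
Lemma gallai U : (forall v, v \in U -> maxcov (U :\ v) = maxcov U) ->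
  forall m, matching U m -> #|covered m| = maxcov U ->
  forall x y, x \in U -> y \in U -> m x = x -> m y = y ->
  connect [rel a b | [&& a \in U, b \in U & g a b]] x y -> x = y.
Proof.
move=> HU m0 M0 c0.
pose apart x y := x = y \/ forall m, matching U m -> #|covered m| = maxcov U -> m x = x -> m y <> y.
suff ap : forall x y, connect [rel a b | [&& a \in U, b \in U & g a b]] x y -> apart x y.
  by move=> x y xU yU mx my /ap [//|/(_ m0 M0 c0 mx)].
have trans x y z : y \in U -> apart x y -> apart y z -> apart x z.
  move=> yU [->//|axy] [<-|ayz]; first by right.
  have [->|/eqP xz] := eqVneq x z; [by left | right => m1 M1 c1 m1x m1z].
  have m1y : m1 y <> y := axy m1 M1 c1 m1x.
  have [m2 M2' c2'] := maxcovP (U :\ y).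
  have M2 := matchingS (subsetDl _ _) M2'.
  have c2 : #|covered m2| = maxcov U by rewrite c2' HU.
  have m2y : m2 y = y.
    apply/eqP/negPn/negP => /(proj2 (matchingP _ _ M2')) [_].
    by rewrite setD11.
  have [I1 _] := matchingP _ _ M1; have [I2 _] := matchingP _ _ M2.
  have S1 := orb_stable1 y I1 I2; have S2 := orb_stable2 y I1 I2.
  (* The exchange along the alternating path from [y] gives a maximum matching that misses [y]. That
     path has one other end at most, so [x] or [z] is off it and stays missed too. *)
  have MS := matching_swap M1 M2 S1 S2; have cS := cov_swap M1 M2 S1 S2 c1 c2.
  have yO : y \in orb m1 m2 y by rewrite inE connect0.
  have [xO|xO] := boolP (x \in orb m1 m2 y); last first.
    by apply: (axy _ MS cS); rewrite ffunE ?(negPf xO) ?yO.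
  have [zO|zO] := boolP (z \in orb m1 m2 y); last first.
    by apply: (ayz _ MS cS); rewrite ffunE ?(negPf zO) ?yO.
  by apply: xz; apply: (orb_end_uniq I1 I2 m2y xO zO m1x m1z).
have adj x y : x \in U -> y \in U -> g x y -> apart x y.
  move=> xU yU gxy; have [->|xy] := eqVneq x y; [by left | right => m M cm mx my].
  have [mI mH] := matchingP _ _ M.
  pose m' := [ffun z => if z == x then y else if z == y then x else m z].
  have mne z : z != x -> z != y -> (m z != x) && (m z != y).
    have ne w : m w = w -> z != w -> m z != w.
      by move=> mw; apply: contraNneq => zw; rewrite -(mI z) zw mw.
    by move=> zx zy; rewrite !ne.
  have M' : matching U m'.
    apply/matchingP; split=> z; rewrite !ffunE.
      have [->|zx] := eqVneq z x; first by rewrite eqxx eq_sym (negPf xy).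
      have [->|zy] := eqVneq z y; first by rewrite eqxx.
      by have /andP[/negPf -> /negPf ->] := mne z zx zy; rewrite mI.
    have [->|zx] := eqVneq z x; first by [].
    have [->|zy] := eqVneq z y; first by rewrite gsym.
    exact: mH.
  have := leq_maxcov M'; rewrite -cm leqNgt => /negP; apply.
  apply: proper_card; apply/properP; split.
    apply/subsetP => z; rewrite !inE ffunE => mz.
    have [->|zx] := eqVneq z x; first by rewrite eq_sym.
    by have [->|zy] := eqVneq z y.
  by exists x; rewrite !inE ?ffunE ?eqxx ?mx ?eqxx // eq_sym.
move=> x _ /connectP[p pp ->]; elim: p x pp => [|y p IHp] x /=; first by left.
case/andP => /and3P[xU yU gxy] pp.
by apply: trans (adj x y xU yU gxy) (IHp y pp).
Qed.

(* [f] names the components of [U] minus [A]; all of them are counted, not only the odd ones. *)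
Lemma tutte_berge (U : {set T}) : exists (m : {ffun T -> T}) (A : {set T}) (f : T -> T),
  [/\ matching U m, A \subset U,
      {in U :\: A &, forall x y, g x y -> f x = f y} &
      #|U| + #|A| <= #|covered m| + #|f @: (U :\: A)|].
Proof.
move En : #|U| => n; elim: n U En => [|n IHn] U En.
  exists [ffun x => x], set0, id; split; rewrite ?matching_id ?sub0set ?cards0 //.
  by have /eqP := En; rewrite cards_eq0 => /eqP -> x y; rewrite setD0 inE.
have [/exists_inP[v vU ne]|/exists_inPn eq] := boolP [exists v in U, maxcov (U :\ v) != maxcov U].
  (* A vertex [v] covered by every maximum matching goes into [A]. Numbers of covered vertices are
     even, so at least two are lost with [v]; this pays for [v] in [U] and in [A]. *)
  have cU' : #|U :\ v| = n by move: En; rewrite (cardsD1 v) vU => -[].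
  have [m' [A [f [M' sA Hf le]]]] := IHn _ cU'.
  have [m M cm] := maxcovP U.
  have DA : U :\: (v |: A) = (U :\ v) :\: A by rewrite setDDl.
  exists m, (v |: A), f; split=> //; rewrite ?DA //.
    by rewrite subUset sub1set vU (subset_trans sA (subsetDl _ _)).
  have [m2 M2 c2] := maxcovP (U :\ v).
  have lt : maxcov (U :\ v) < maxcov U.
    rewrite ltn_neqAle ne -c2; apply: leq_maxcov; exact: matchingS (subsetDl _ _) M2.
  have l' := leq_maxcov M'.
  have vA : v \notin A by apply/negP => /(subsetP sA); rewrite setD11.
  rewrite cardsU1 vA; move: (covered_double M) (covered_double M2) lt l' le.
  by rewrite cm c2 => -> -> ; rewrite -!muln2; lia.
have HU v : v \in U -> maxcov (U :\ v) = maxcov U by move=> /eq; rewrite negbK => /eqP.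
(* Here [A] is empty: by Gallai's lemma the uncovered vertices lie in different components. *)
have [m M cm] := maxcovP U.
pose h := [rel a b | [&& a \in U, b \in U & g a b]].
have hs : connect_sym h.
  by apply: sym_connect_sym => a b /=; rewrite gsym andbCA.
exists m, set0, (fun x => fingraph.root h x); split; rewrite ?sub0set //.
  move=> x y; rewrite !setD0 => xU yU gxy; apply/eqP; rewrite (root_connect hs).
  by apply: connect1; rewrite /= xU yU.
rewrite setD0 cards0 addn0.
have sc : covered m \subset U.
  by apply/subsetP => x; rewrite inE => /(proj2 (matchingP _ _ M)) [].
rewrite -En -(cardsID (covered m) U) (setIidPr sc) leq_add2l.
rewrite -(@card_in_imset _ _ (fun x => fingraph.root h x) (U :\: covered m)); last first.
  move=> x y; rewrite !inE !negbK => /andP[/eqP mx xU] /andP[/eqP my yU] /eqP.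
  rewrite (root_connect hs) => cxy; exact: (gallai HU M cm xU yU mx my cxy).
by apply: subset_leq_card; apply: imsetS; apply: subsetDl.
Qed.

End Matching.

(** * Elimination orders of chordal graphs *)

Section ShortestPath.
Variables (T : finType) (h : rel T).

Lemma last_take (x : T) p i : i <= size p -> last x (take i p) = nth x (x :: p) i.
Proof.
move=> ip; rewrite (last_nth x) size_takel //.
by case: i ip => //= i ip; rewrite nth_take.
Qed.

Lemma path_shortcut x p i j : path h x p -> i < j <= size p ->
  h (nth x (x :: p) i) (nth x (x :: p) j) ->
  path h x (take i p ++ drop j.-1 p) /\ last x (take i p ++ drop j.-1 p) = last x p.
Proof.
case: j => // j pp /andP[ij jp] hij.
have ip : i <= size p by lia.
have pd : drop j p = nth x p j :: drop j.+1 p by apply: drop_nth.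
have p1 : path h x (take i p).
  by move: pp; rewrite -{1}(cat_take_drop i p) cat_path => /andP[].
have p2 : path h (nth x p j) (drop j.+1 p).
  move: pp; rewrite -{1}(cat_take_drop j.+1 p) cat_path => /andP[_].
  by rewrite last_take.
split; first by rewrite cat_path last_take //= p1 pd /= hij.
rewrite last_cat pd /= -[in RHS](cat_take_drop j.+1 p) last_cat.
by rewrite (last_take _ jp) /=.
Qed.

Lemma shortest_path x y : connect h x y -> exists p,
  [/\ path h x p, last x p = y, uniq (x :: p) &
   forall i j, i < j <= size p -> h (nth x (x :: p) i) (nth x (x :: p) j) -> j = i.+1].
Proof.
case/connectP => p0 pp0 lp0.
have ex : exists n, [exists p : n.-tuple T, path h x p && (last x p == y)].
  by exists (size p0); apply/existsP; exists (in_tuple p0); rewrite pp0 -lp0 eqxx.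
case: (ex_minnP ex) => n /existsP[[p /= /eqP sp] /andP[pp /eqP lp]] minn {p0 pp0 lp0 ex}.
have min q : path h x q -> last x q = y -> n <= size q.
  by move=> pq lq; apply: minn; apply/existsP; exists (in_tuple q); rewrite /= pq lq eqxx.
case: (shortenP pp) lp => q pq uq sq lq.
have {}sq : size q <= n by rewrite -sp; apply: uniq_leq_size sq; case/andP: uq.
exists q; split=> // i j /andP[ij jq] hij.
have [p' l'] := path_shortcut pq (introT andP (conj ij jq)) hij.
have := min _ p'; rewrite l' => /(_ lq); rewrite size_cat size_drop size_takel; last by lia.
case: j ij jq {hij p' l'} => //= j; move: sq; move: (size q) => m; lia.
Qed.

End ShortestPath.

Section Chordal.
Variables (T : finType) (e : rel T).
Hypotheses (esym : symmetric e) (eirr : irreflexive e) (ch : chordal e).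

Definition simplicial_in (U : {set T}) s :=
  {in U &, forall x y, e s x -> e s y -> x != y -> e x y}.

(* A chordless path between two nonadjacent neighbours of [r] avoiding the other
   neighbours of [r] closes up with [r] to an induced cycle. *)
Lemma nbr_clique r a b (R : {set T}) : (forall x, x \in R -> x != r /\ ~~ e r x) ->
  e r a -> e r b -> a != b ->
  connect [rel x y | [&& x \in a |: (b |: R), y \in a |: (b |: R) & e x y]] a b -> e a b.
Proof.
move=> HR ra rb ab cab; apply: contraT => nab; case: ch.
have [p [pp lp up indp]] := shortest_path cab.
set h := [rel x y | _] in cab pp indp.
have he : subrel h e by move=> x y /and3P[].
have inW x : x \in a :: p -> x \in a |: (b |: R).
  rewrite in_cons => /predU1P[->|xp]; first by rewrite setU11.
  have inp u : path h u p -> x \in a |: (b |: R).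
    elim: p u xp {pp lp up indp} => //= y p IHp u.
    rewrite in_cons => /predU1P[->|xp] /andP[/and3P[_ yW _] pp] //.
    exact: IHp xp pp.
  exact: inp pp.
have p2 : 2 <= size p.
  case: p pp lp {up indp inW} => [|y [|//]] /=; first by move=> _ eab; rewrite eab eqxx in ab.
  by rewrite andbT => /and3P[_ _ ay] yb; rewrite -yb ay in nab.
have rp : r \notin a :: p.
  apply/negP => /inW; rewrite !in_setU1 => /or3P[/eqP ra'|/eqP rb'|/HR[]].
  - by rewrite ra' eirr in ra.
  - by rewrite rb' eirr in rb.
  - by rewrite eqxx.
exists (r :: a :: p); split=> //=.
split.
  split; last by rewrite /= !ltnS ltnW.
  apply/andP; split; last by rewrite cons_uniq rp up.
  rewrite /= ra rcons_path lp [e b r]esym rb andbT.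
  exact: sub_path he _ _ pp.
have next_r x : x \in a :: p -> e r x -> x = a \/ x = b.
  move=> /inW; rewrite !in_setU1 => /or3P[/eqP|/eqP|/HR[_ /negPf ->]]; by [left | right |].
have lb : nth r (a :: p) (size p) = b by rewrite -lp (last_nth r).
have nr : next (r :: a :: p) r = a by rewrite next_nth inE eqxx /= eqxx.
have nb : next (r :: a :: p) b = r.
  have bp : b \in a :: p by rewrite -lp mem_last.
  have rb' : (r == b) = false by apply: contraNF rp => /eqP ->.
  rewrite next_nth in_cons bp orbT /= rb' -[X in nth _ _ X.+1](_ : size p = _) ?nth_default //.
  by have := @index_uniq _ r (size p) (a :: p) (ltnSn _) up; rewrite lb /= => ->.
have nn i : i < size p -> next (r :: a :: p) (nth r (a :: p) i) = nth r (a :: p) i.+1.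
  move=> ip; have ip' : nth r (a :: p) i \in a :: p by apply: mem_nth; rewrite /= ltnS ltnW.
  have ri : (r == nth r (a :: p) i) = false by apply: contraNF rp => /eqP {1}->.
  have Ei := @index_uniq _ r i (a :: p) (ltnW ip) up.
  move: ip' ri Ei; set z := nth r (a :: p) i => zp rz Ez.
  rewrite next_nth in_cons zp orbT.
  by have -> : index z [:: r, a & p] = (index z (a :: p)).+1; [rewrite [LHS]/= rz | rewrite Ez].
have key x y : x \in a :: p -> y \in a :: p -> index x (a :: p) < index y (a :: p) -> e x y ->
  next (r :: a :: p) x = y.
  move=> xp yp ij exy.
  have jp : index y (a :: p) <= size p by rewrite -ltnS -[(size p).+1]/(size (a :: p)) index_mem.
  have Ej : index y (a :: p) = (index x (a :: p)).+1.
    apply: indp; first by rewrite ij jp.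
    by rewrite !nth_index //= exy !inW.
  by rewrite -{1}(nth_index r xp) nn -?Ej ?nth_index // -ltnS -Ej ltnS.
move=> x y; rewrite !(in_cons r) => /predU1P[->|xp] /predU1P[->|yp].
- by rewrite eirr.
- by move=> /(next_r y yp) [->|->]; [left | right].
- by rewrite esym => /(next_r x xp) [->|->]; [right | left].
have [ij|ij|ij] := ltngtP (index x (a :: p)) (index y (a :: p)) => exy.
- by left; apply: key.
- by right; apply: key; rewrite // esym.
- by move: exy; rewrite -(nth_index r xp) ij nth_index // eirr.
Qed.

(** Let [K] be the component of [v] among the nonneighbours of [r], and [N] its outer neighbours, a
    clique by [nbr_clique]. A vertex of [K] simplicial in [K :|: N] is simplicial in [U], and
    [K :|: N] is smaller than [U] because it misses [r]. *)
Lemma dirac (U : {set T}) r v : r \in U -> v \in U -> v != r -> ~~ e r v ->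
  exists s, [/\ s \in U, s != r, ~~ e r s & simplicial_in U s].
Proof.
move En : #|U| => n; elim/ltn_ind: n U r v En => n IHn U r v En rU vU vr nrv.
pose R := [set x in U | (x != r) && ~~ e r x].
have vR : v \in R by rewrite inE vU vr.
have HR x : x \in R -> x != r /\ ~~ e r x by rewrite inE => /andP[_ /andP[]].
pose h := [rel x y | [&& x \in R, y \in R & e x y]].
have hs : connect_sym h by apply: sym_connect_sym => x y /=; rewrite esym andbCA.
pose K := [set x | (x \in R) && connect h v x].
have vK : v \in K by rewrite inE vR connect0.
have KR x : x \in K -> x \in R by rewrite inE => /andP[].
have Kcl x k : k \in K -> x \in R -> e k x -> x \in K.
  move=> kK xR ekx; have := kK; rewrite !inE => /andP[kR vk]; rewrite inE in xR.
  rewrite xR /=; apply: connect_trans vk _; apply: connect1.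
  by rewrite /= ekx (KR k kK) inE xR.
pose N := [set a in U | (a \notin K) && [exists k in K, e a k]].
have Nr a : a \in N -> e r a.
  rewrite inE => /andP[aU /andP[aK /exists_inP[k kK ak]]].
  have [ar|ar] := eqVneq a r; first by move: ak; rewrite ar; have [_ /negPf ->] := HR k (KR k kK).
  apply: contraT => nra; case/negP: aK; apply: (Kcl a k kK); last by rewrite esym.
  by rewrite inE aU ar.
have Ncl a b : a \in N -> b \in N -> a != b -> e a b.
  move=> aN bN ab; apply: (nbr_clique HR) (Nr a aN) (Nr b bN) ab _.
  have := aN; have := bN; rewrite !inE => /andP[_ /andP[_ /exists_inP[l lK bl]]] /andP[_ /andP[_ /exists_inP[k kK ak]]].
  apply: (@connect_trans _ _ k); first by apply: connect1; rewrite /= ak setU11 !in_setU1 (KR k kK) !orbT.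
  apply: (@connect_trans _ _ l); last first.
    by apply: connect1; rewrite /= esym bl !in_setU1 (KR l lK) eqxx !orbT.
  have : connect h k l.
    move: kK lK; rewrite !inE => /andP[_ vk] /andP[_ vl].
    by apply: connect_trans vl; rewrite hs.
  apply: connect_sub => x y /and3P[xR yR exy]; apply: connect1.
  by rewrite /= exy !in_setU1 xR yR !orbT.
pose U' := K :|: N.
have U'U : U' \subset U.
  apply/subsetP => x; rewrite in_setU => /orP[/KR|]; rewrite inE => /andP[] //.
have rU' : r \notin U'.
  apply/negP; rewrite in_setU => /orP[/KR/HR[]|/Nr]; first by rewrite eqxx.
  by rewrite eirr.
have ltU : #|U'| < n.
  by rewrite -En; apply: proper_card; apply/properP; split=> //; exists r.
have fin s : s \in K -> simplicial_in U' s -> exists s, [/\ s \in U, s != r, ~~ e r s & simplicial_in U s].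
  move=> sK sS; have [sr nrs] := HR s (KR s sK).
  have nbU x : x \in U -> e s x -> x \in U'.
    move=> xU esx; rewrite in_setU; case: (boolP (x \in K)) => //= xK.
    by rewrite inE xU xK; apply/exists_inP; exists s; rewrite // esym.
  exists s; split=> //; first by have := KR s sK; rewrite inE => /andP[].
  by move=> x y xU yU sx sy; apply: sS => //; apply: nbU.
(* Induction from an [r'] that dominates [N] returns a vertex not adjacent to [r'], hence one in
   [K]. If no such [r'] has a nonneighbour, [K :|: N] is a clique. *)
have useIH r' v' : r' \in U' -> v' \in U' -> v' != r' -> ~~ e r' v' ->
    (forall a, a \in N -> a = r' \/ e r' a) ->
    exists s, [/\ s \in U, s != r, ~~ e r s & simplicial_in U s].
  move=> r'U v'U vr' nrv' Hr'; have [s [sU sr nrs sS]] := IHn _ ltU U' r' v' (erefl _) r'U v'U vr' nrv'.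
  apply: (fin s) => //; move: sU; rewrite in_setU => /orP[//|/Hr'[sr'|]].
    by rewrite sr' eqxx in sr.
  by rewrite (negPf nrs).
have [/exists_inP[a aN /exists_inP[w wU /andP[wa naw]]]|/exists_inPn H1] :=
  boolP [exists a in N, exists w in U', (w != a) && ~~ e a w].
  apply: (useIH a w) => // [|b bN]; first by rewrite in_setU aN orbT.
  by have [->|ab] := eqVneq b a; [left | right; apply: Ncl; rewrite // eq_sym].
have [/exists_inP[k kK /exists_inP[w wU /andP[wk nkw]]]|/exists_inPn H2] :=
  boolP [exists k in K, exists w in U', (w != k) && ~~ e k w].
  apply: (useIH k w) => // [|b bN]; first by rewrite in_setU kK.
  right; rewrite esym; apply: contraT => nbk.
  have /exists_inPn/(_ k) := H1 b bN; rewrite in_setU kK nbk andbT negbK => /(_ isT)/eqP kb.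
  by move: bN; rewrite -kb inE kK andbF.
apply: (fin v vK) => x y xU yU _ _ xy.
move: xU; rewrite in_setU => /orP[/H2|/H1] /exists_inPn/(_ y yU);
  by rewrite eq_sym xy /= negbK.
Qed.

(** While a nonneighbour of [r] remains, [dirac] supplies a simplicial one to be eliminated; then
    the clique of [r] and its neighbours is left, and [r] goes first. This order makes the greedy
    set contain [r], so that each other chosen vertex is cut off from [r] by its later
    neighbours. *)
Lemma elimination_order_in (U : {set T}) r : simplicial_in setT r -> r \in U ->
  (forall x, e r x -> x \in U) -> exists f : T -> nat,
  [/\ {in U &, injective f},
      {in U & U & U, forall x y z, f x < f y -> f x < f z -> e x y -> e x z -> y != z -> e y z},
      {in U, forall x, x != r -> ~~ e r x -> f x < f r} &
      {in U, forall x, e r x -> f r < f x}].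
Proof.
move=> rS; move En : #|U| => n; elim: n U En => [|n IHn] U En rU NU.
  by move: rU; have /eqP := En; rewrite cards_eq0 => /eqP ->; rewrite inE.
have [/exists_inP[v vU /andP[vr nrv]]|/exists_inPn H] := boolP [exists v in U, (v != r) && ~~ e r v].
  have [s [sU sr nrs sS]] := dirac rU vU vr nrv.
  have cU : #|U :\ s| = n by move: En; rewrite (cardsD1 s) sU => -[].
  have [|x rx|f [h1 h2 h3 h4]] := IHn _ cU; first by rewrite !inE eq_sym sr.
    by rewrite !inE NU // andbT; apply: contraNneq nrs => <-.
  exists (fun x => if x == s then 0 else (f x).+1); split.
  - move=> x y xU yU; case: (x =P s) => [->|/eqP xs]; case: (y =P s) => [->|/eqP ys] //.
    by case; apply: h1; rewrite !inE ?xs ?ys.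
  - move=> x y z xU yU zU; case: (y =P s) => // /eqP ys; case: (z =P s) => // /eqP zs.
    case: (x =P s) => [->|/eqP xs]; first by move=> _ _; apply: sS.
    by rewrite !ltnS; apply: h2; rewrite !inE ?xs ?ys ?zs.
  - move=> x xU xr nrx; rewrite [r == s]eq_sym (negPf sr); case: (x =P s) => // /eqP xs.
    by rewrite ltnS; apply: h3; rewrite // !inE xs.
  - move=> x xU rx; rewrite [r == s]eq_sym (negPf sr).
    have xs : x != s by apply: contraNneq nrs => <-.
    by rewrite (negPf xs) ltnS; apply: h4; rewrite // !inE xs.
have Hr x : x \in U -> x != r -> e r x.
  by move=> xU xr; have := H x xU; rewrite xr negbK.
exists (fun x => if x == r then 0 else (enum_rank x).+1); split.
- move=> x y xU yU; case: (x =P r) => [->|_]; case: (y =P r) => [->|_] //.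
  by case=> /val_inj/enum_rank_inj.
- move=> x y z xU yU zU; case: (y =P r) => // /eqP yr; case: (z =P r) => // /eqP zr _ _ _ _ yz.
  by apply: rS; rewrite ?inE // Hr.
- by move=> x xU xr; rewrite Hr.
- by move=> x xU rx; rewrite eqxx; case: (x =P r) => // xr; rewrite xr eirr in rx.
Qed.

Lemma greedy_stable (f : T -> nat) : injective f -> exists X : {set T},
  {in X &, forall x y, ~~ e x y} /\
  forall v, v \in X \/ exists2 x, x \in X & f x < f v /\ e x v.
Proof.
move=> fI.
suff H n : exists X : {set T}, [/\ {in X &, forall x y, ~~ e x y},
  {in X, forall x, f x < n} &
  forall v, f v < n -> v \in X \/ exists2 x, x \in X & f x < f v /\ e x v].
  have [X [h1 _ h3]] := H (\max_v f v).+1; exists X; split=> // v; apply: h3.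
  by rewrite ltnS; apply: leq_bigmax.
elim: n => [|n [X [h1 h2 h3]]]; first by exists set0; split=> // x; rewrite inE.
have [/existsP[v /andP[/eqP fv /exists_inPn nv]]|/existsPn nv] :=
  boolP [exists v, (f v == n) && ~~ [exists x in X, e x v]]; last first.
  exists X; split=> // [x xX|v]; first by rewrite ltnW // ltnS h2.
  rewrite ltnS leq_eqVlt => /orP[/eqP fv|/h3 //]; right.
  have := nv v; rewrite fv eqxx negbK => /exists_inP[x xX exv].
  by exists x => //; rewrite h2.
exists (v |: X); split.
- move=> x y; rewrite !in_setU1 => /predU1P[->|xX] /predU1P[->|yX].
  + by rewrite eirr.
  + by rewrite esym nv.
  + by rewrite nv.
  + exact: h1.
- by move=> x /setU1P[->|xX]; rewrite ltnS ?fv // ltnW // h2.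
move=> w; rewrite ltnS leq_eqVlt => /orP[/eqP fw|/h3].
  by left; rewrite (_ : w = v) ?setU11 //; apply: fI; rewrite fw.
case=> [wX|[x xX H]]; first by left; rewrite in_setU1 wX orbT.
by right; exists x; rewrite // in_setU1 xX orbT.
Qed.

(** Along a shortest path avoiding [S] the rank only decreases. The first step cannot rise without
    entering [S]; at a later first rise, the lowest vertex would have both its path neighbours later
    in the order, hence adjacent, a shortcut. *)
Lemma elimination_separates (f : T -> nat) (S : {set T}) x y :
  (forall x y z, f x < f y -> f x < f z -> e x y -> e x z -> y != z -> e y z) ->
  f x < f y -> (forall z, e x z -> f x < f z -> z \in S) -> injective f ->
  ~~ connect (del_rel e S) x y.
Proof.
move=> fE fxy HS fI; apply/negP => /shortest_path [p [pp lp up indp]].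
pose s i := nth x (x :: p) i.
have hs i : i < size p -> del_rel e S (s i) (s i.+1).
  by move=> ip; have /(pathP x)/(_ i ip) := pp.
have sp : s (size p) = y by rewrite /s -last_nth.
have sU i j : i <= size p -> j <= size p -> s i = s j -> i = j.
  by move=> ip jp /eqP; rewrite nth_uniq // => /eqP.
have p0 : 0 < size p by case: p lp {pp up indp s hs sp sU} => //= xy; rewrite xy ltnn in fxy.
have dec i : i < size p -> f (s i.+1) < f (s i).
  elim: i => [|i IHi] ip.
    have /and3P[n0 n1 e01] := hs 0 p0.
    rewrite ltnNge leq_eqVlt negb_or; apply/andP; split.
      by apply/negP => /eqP/fI/(sU 0 1 _ p0) => /(_ isT).
    by apply/negP => lt; case/negP: n1; apply: HS.
  have IH := IHi (ltnW ip); rewrite ltnNge leq_eqVlt negb_or; apply/andP; split.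
    by apply/negP => /eqP/fI/(sU i.+1 i.+2 (ltnW ip) ip) /eqP; rewrite eqn_leq ltnn andbF.
  apply/negP => lt; have /and3P[n0 n1 e01] := hs i (ltnW ip); have /and3P[_ n2 e12] := hs _ ip.
  have [] : i.+2 <> i.+1 by move/eqP; rewrite eqn_leq ltnn.
  apply: indp; first by rewrite ip andbT.
  rewrite /del_rel /= n0 n2; apply: (fE (s i.+1)) => //; first by rewrite esym.
  by apply/negP => /eqP/(sU i i.+2 (ltnW (ltnW ip)) ip) /eqP; rewrite eqn_leq ltnNge leqnSn andbF.
have : f (s (size p)) <= f x.
  suff : forall i, i <= size p -> f (s i) <= f x by apply.
  elim=> [//|i IHi ip]; exact: leq_trans (ltnW (dec i ip)) (IHi (ltnW ip)).
by rewrite sp leqNgt fxy.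
Qed.

Lemma del_connect_sym (S : {set T}) : connect_sym (del_rel e S).
Proof. by apply: sym_connect_sym => x y; rewrite /del_rel /= esym andbCA. Qed.

Lemma ncomp_ge (S A : {set T}) : [disjoint A & S] ->
  {in A &, forall x y, x != y -> ~~ connect (del_rel e S) x y} -> #|A| <= ncomp_del e S.
Proof.
move=> dAS HA; have hs : connect_sym (del_rel e S).
  exact: del_connect_sym.
have inS x : x \notin S -> fingraph.root (del_rel e S) x \notin S.
  move=> xS; have /connectP[p pp ->] := connect_root (del_rel e S) x.
  elim: p x xS pp => //= y p IHp x xS /andP[/and3P[_ yS _]]; exact: IHp.
rewrite -(@card_in_imset _ _ (fingraph.root (del_rel e S)) A) => [|x y xA yA].
  apply: subset_leq_card; apply/subsetP => _ /imsetP[x xA ->].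
  rewrite !inE roots_root //=; apply: inS; rewrite (disjointFr dAS xA) //.
by move/eqP; rewrite root_connect // => cxy; apply/eqP; apply: contraTT cxy; apply: HA.
Qed.

Hypothesis tgh : forall S : {set T}, separating e S -> 10 * ncomp_del e S <= #|S|.

Lemma tough_card (S A : {set T}) : 1 < #|A| -> [disjoint A & S] ->
  {in A &, forall x y, x != y -> ~~ connect (del_rel e S) x y} -> 10 * #|A| <= #|S|.
Proof.
move=> A1 dAS HA; have le := ncomp_ge dAS HA.
by apply: leq_trans (tgh _); rewrite ?leq_mul2l ?le ?orbT // /separating (leq_trans A1).
Qed.

(* [X] is a maximal independent set chosen greedily along an elimination order ending in
   [r], N(r), and [Q x] consists of [x] and its later neighbours. *)
Lemma clique_cover : ~~ complete_graph e -> exists (X : {set T}) (Q : T -> {set T}),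
  [/\ forall x, x \in X -> x \in Q x /\ 20 < #|Q x|,
      forall x, {in Q x &, forall y z, y != z -> e y z},
      forall v, exists2 x, x \in X & v \in Q x,
      forall x y, x \in X -> y \in X -> x \in Q y -> x = y &
      forall (Y S : {set T}), Y \subset X -> [disjoint Y & S] ->
        (forall y, y \in Y -> Q y :\ y \subset S) ->
        {in Y &, forall x y, x != y -> ~~ connect (del_rel e S) x y}].
Proof.
case/forallPn => u /forallPn[v]; rewrite negb_imply => /andP[uv nuv].
have [r [_ ru nur rS]] : exists r, [/\ r \in setT, r != u, ~~ e u r & simplicial_in setT r].
  by apply: (@dirac _ _ v); rewrite ?inE // eq_sym.
have [||f [fI' fE' fr' fN']] := @elimination_order_in setT r rS; rewrite ?inE //.
have fI : injective f by move=> x y; apply: fI'; rewrite inE.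
have fE x y z : f x < f y -> f x < f z -> e x y -> e x z -> y != z -> e y z.
  by apply: fE'; rewrite inE.
have [X [Xi Xd]] := greedy_stable fI.
pose Q x := x |: [set y | e x y & f x < f y].
have sep x y (S : {set T}) : f x < f y -> Q x :\ x \subset S -> ~~ connect (del_rel e S) x y.
  move=> fxy QS; apply: (elimination_separates fE fxy _ fI) => z exz fxz.
  apply: (subsetP QS); rewrite !inE exz fxz orbT andbT.
  by apply: contraTneq exz => ->; rewrite eirr.
have rX : r \in X.
  have [//|[x xX [fxr exr]]] := Xd r.
  by have := fN' x (in_setT _); rewrite esym exr ltnNge ltnW // => /(_ isT).
(* [Q x :\ x] separates [x] from [y]; toughness 10 with two components gives it at least 20
   vertices. *)
have big x y : x != y -> ~~ connect (del_rel e (Q x :\ x)) x y -> y \notin Q x -> 20 < #|Q x|.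
  move=> xy nc yQ; rewrite (cardsD1 x) setU11 add1n ltnS.
  have := @tough_card (Q x :\ x) [set x; y]; rewrite cards2 xy; apply=> //.
    rewrite disjoints_subset; apply/subsetP => z /set2P[] ->; rewrite in_setC in_setD1.
      by rewrite eqxx.
    by rewrite (negPf yQ) andbF.
  by move=> a b /set2P[] -> /set2P[] ->; rewrite ?eqxx // del_connect_sym.
exists X, Q; split.
- move=> x xX; split; first exact: setU11.
  have [xr|xr] := eqVneq x r.
    apply: (big x u); rewrite ?xr //.
      apply/negP => /connectP[[|y p] /= pp lp]; first by rewrite lp eqxx in ru.
      case/andP: pp => /and3P[_ yS ry] _; case/negP: yS.
      rewrite !inE ry fN' ?inE // orbT andbT.
      by apply: contraTneq ry => ->; rewrite eirr.
    by rewrite !inE eq_sym (negPf ru) /= esym (negPf nur).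
  have nxr : ~~ e x r := Xi x r xX rX.
  have fxr : f x < f r by apply: fr'; rewrite ?inE // esym.
  apply: (big x r) => //; first by apply: sep.
  by rewrite !inE eq_sym (negPf xr) (negPf nxr).
- move=> x y z; rewrite !inE => /orP[/eqP ->|/andP[xy fxy]] /orP[/eqP ->|/andP[xz fxz]] yz //.
  + by rewrite eqxx in yz.
  + by rewrite esym.
  + exact: (fE x).
- move=> w; have [wX|[x xX [fxw exw]]] := Xd w; first by exists w; rewrite // setU11.
  by exists x; rewrite // !inE exw fxw orbT.
- move=> x y xX yX; rewrite !inE => /orP[/eqP //|/andP[exy _]].
  by have := Xi y x yX xX; rewrite exy.
move=> Y S YX dYS HQ x y xY yY xy.
have [fxy|fyx|/fI fxy] := ltngtP (f x) (f y).
- exact: sep fxy (HQ x xY).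
- by rewrite del_connect_sym; apply: sep fyx (HQ y yY).
- by rewrite fxy eqxx in xy.
Qed.

End Chordal.

(** * Disjoint links across a partition *)

(** The toughness bounds on both cuts would add up to at least 10q, against 8q - 12. A cut that
    isolates fewer than two pieces gives no such bound, but this loses at most 10; if it happens to
    both, then q = 2 and the clique bound 20 on [s0] decides. *)
Lemma cut_arith s0 s1 m y b d q : s0 + s1 <= 2 * m -> (1 < d -> 10 * d <= s1) ->
  (1 < y -> 10 * y <= s0) -> (0 < y -> 19 < s0) -> b <= y -> q = d + b ->
  m + 5 < 4 * q -> 1 < q -> False.
Proof.
have [d1|d1] := leqP d 1; have [y1|y1] := leqP y 1; have [y0|y0] := posnP y; lia.
Qed.

Section CrossingLinks.
Variables (T : finType) (e : rel T).
Hypotheses (esym : symmetric e) (eirr : irreflexive e).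
Hypothesis tgh : forall S : {set T}, separating e S -> 10 * ncomp_del e S <= #|S|.
Variables (X : {set T}) (Q : T -> {set T}).
Hypothesis QX : forall x, x \in X -> x \in Q x /\ 20 < #|Q x|.
Hypothesis Qcov : forall v, exists2 x, x \in X & v \in Q x.
Hypothesis Qown : forall x y, x \in X -> y \in X -> x \in Q y -> x = y.
Hypothesis Qsep : forall (Y S : {set T}), Y \subset X -> [disjoint Y & S] ->
  (forall y, y \in Y -> Q y :\ y \subset S) ->
  {in Y &, forall x y, x != y -> ~~ connect (del_rel e S) x y}.

(* [(x, y, (a, b))] is a connection from the clique of [x] to the clique of [y]:
   a common vertex [a = b], or an edge from [a] to [b]. *)
Notation link := (T * T * (T * T))%type.
Definition is_link (l : link) := [&& l.1.1 \in X, l.1.2 \in X, l.2.1 \in Q l.1.1,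
  l.2.2 \in Q l.1.2 & (l.2.1 == l.2.2) || e l.2.1 l.2.2].
Definition lverts (l : link) : {set T} := [set l.2.1; l.2.2].

Variables (PT : finType) (P : T -> PT).

Lemma crossing_links : 1 < #|P @: X| -> exists M : {set link},
  [/\ forall l, l \in M -> is_link l && (P l.1.1 != P l.1.2),
      {in M &, forall l l', l != l' -> [disjoint lverts l & lverts l']} &
      4 * #|P @: X| <= #|M| + 5].
Proof.
set Pt := P @: X => q2.
have [h Hh] : exists h : T -> T, forall v, h v \in X /\ v \in Q (h v).
  apply: (fin_all_exists (P := fun v x => x \in X /\ v \in Q x)) => v.
  by have [x xX vx] := Qcov v; exists x.
pose pt v := P (h v).
have ptPt v : pt v \in Pt by apply: imset_f; case: (Hh v).
(* Each vertex lying in cliques of different parts is a crossing link by itself; outside [W], [pt v]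
   does not depend on the chosen clique. *)
pose W := [set v | [exists x in X, (v \in Q x) && (P x != pt v)]].
have WE v x : v \notin W -> x \in X -> v \in Q x -> P x = pt v.
  move=> vW xX vx; apply/eqP; apply: contraNT vW => ne; rewrite inE.
  by apply/exists_inP; exists x; rewrite ?vx.
have hX x : x \in X -> h x = x.
  by move=> xX; have [hX xh] := Hh x; rewrite [RHS](Qown xX hX xh).
have XW x : x \in X -> x \notin W.
  move=> xX; rewrite inE; apply/exists_inPn => y yX; rewrite negb_and.
  case: (boolP (x \in Q y)) => //= xy; rewrite negbK.
  by rewrite /pt hX // (Qown xX yX xy).
have [i Hi] : exists i : T -> T, forall v, v \in W -> [/\ i v \in X, v \in Q (i v) & P (i v) != pt v].
  apply: (fin_all_exists (P := fun v x => v \in W -> [/\ x \in X, v \in Q x & P x != pt v])) => v.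
  have [|vW] := boolP (v \in W); last by exists v.
  by rewrite inE => /exists_inP[x xX /andP[vx ne]]; exists x.
pose g := [rel x y | e x y && (pt x != pt y)].
have gsym : symmetric g by move=> x y; rewrite /g /= esym eq_sym.
have [m [A [f [Mm sA Hf TB]]]] := tutte_berge gsym (~: W).
have [mI mH] := matchingP _ _ _ Mm.
pose lw v : link := (h v, i v, (v, v)).
pose lm v : link := (h v, h (m v), (v, m v)).
pose M := (lw @: W) :|: (lm @: lowers m).
have lowm v : v \in lowers m -> m v != v.
  by rewrite inE; apply: contraTneq => ->; rewrite ltnn.
have lmW v : v \in lowers m -> [/\ e v (m v), pt v != pt (m v), v \notin W & m v \notin W].
  by move=> /lowm/mH[/andP[]]; rewrite !in_setC.
have cM : #|M| = #|W| + #|lowers m|.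
  rewrite cardsU !card_imset; last 2 first.
  - by move=> x y [_ _ ->].
  - by move=> x y [_ _ ->].
  rewrite (_ : _ :&: _ = set0) ?cards0 ?subn0 //.
  apply/setP => l; rewrite !inE; apply/negP => /andP[/imsetP[v vW ->] /imsetP[w wl []]] _ _ vw _.
  by have [_ _ wW _] := lmW w wl; rewrite -vw vW in wW.
exists M; split.
- move=> l; rewrite in_setU => /orP[] /imsetP[v vW ->]; rewrite /is_link /=.
    have [iX vi ne] := Hi v vW; have [hvX vh] := Hh v.
    by rewrite hvX iX vh vi eqxx eq_sym ne.
  have [evm ne _ _] := lmW v vW; have [hvX vh] := Hh v; have [hmX mh] := Hh (m v).
  by rewrite hvX hmX vh mh evm orbT ne.
- have dis1 v w : v \in W -> w \in lowers m -> [disjoint lverts (lw v) & lverts (lm w)].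
    move=> vW wl; have [_ _ wW mW] := lmW w wl; rewrite disjoints_subset.
    apply/subsetP => u /set2P[] ->; rewrite !inE negb_or /=;
    by apply/andP; split; apply: contraTneq vW => ->.
  move=> l l'; rewrite !in_setU => /orP[] /imsetP[v vM ->] /orP[] /imsetP[w wM ->] ne.
  + rewrite disjoints_subset; apply/subsetP => u /set2P[] ->; rewrite !inE /= orbb;
    by apply: contraNneq ne => ->.
  + exact: dis1.
  + by rewrite disjoint_sym; apply: dis1.
  + have vw : v != w by apply: contraNneq ne => ->.
    have vmw : v != m w.
      apply/negP => /eqP vm; move: vM wM; rewrite !inE vm mI => a b.
      by have := ltn_trans a b; rewrite ltnn.
    have mvw : m v != w by apply: contraNneq vmw => <-; rewrite mI.
    have mvmw : m v != m w by rewrite (inj_eq (inv_inj mI)).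
    by rewrite disjoints_subset; apply/subsetP => u /set2P[] ->; rewrite !inE /= negb_or ?vw ?vmw ?mvw ?mvmw.
rewrite leqNgt; apply/negP => small.
(* Incidence between parts and the components left by [A]. Parts in [B] meet only the components in
   [N], at most [#|B|] many; the other parts are given distinct components outside [N]. *)
pose r p j := [exists v, [&& v \notin W, v \notin A, pt v == p & f v == j]].
have [B [psi [sB cN Hpsi Ipsi]]] := hall_deficiency r Pt.
set N := nbh r B setT in cN Hpsi.
pose V2 := ~: W :\: A.
pose J := f @: V2.
have inV2 v : (v \in V2) = (v \notin A) && (v \notin W) by rewrite !inE.
have rN v : v \in V2 -> pt v \in B -> f v \in N.
  rewrite inV2 => /andP[vA vW] vB; rewrite !inE /=; apply/exists_inP; exists (pt v) => //.
  by apply/existsP; exists v; rewrite vA vW !eqxx.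
(* [k] selects the vertex to be spared in each component [j], taken from the part matched with [j]
   if there is one. *)
have [k Hk] : exists k : T -> T, forall j, j \in J ->
    [/\ k j \in V2, f (k j) = j & forall p, p \in Pt :\: B -> psi p = Some j -> pt (k j) = p].
  apply: (fin_all_exists (P := fun j v => j \in J -> [/\ v \in V2, f v = j &
    forall p, p \in Pt :\: B -> psi p = Some j -> pt v = p])) => j.
  have [/exists_inP[p pP /eqP pj]|/exists_inPn np] := boolP [exists p in Pt :\: B, psi p == Some j].
    have [j' pj' /andP[_ /existsP[v /and4P[vW vA /eqP vp /eqP fv]]]] := Hpsi p pP.
    have jj' : j = j' by move: pj'; rewrite pj => -[].
    exists v => _; split; [by rewrite inV2 vA vW | by rewrite fv |] => p' p'P pj''.
    by rewrite vp; apply: Ipsi; rewrite // pj pj''.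
  have [/imsetP[v vV jv]|] := boolP (j \in J); last by exists j.
  exists v => _; split=> // p pP pj.
  by have := np p pP; rewrite pj eqxx.
(* [S0] isolates the vertices of [Y] from each other, and [S1] isolates the parts outside [B]. *)
pose S1 := [set v | [|| v \in W, v \in A | if f v \in N then pt v \notin B else v != k (f v)]].
pose VB := [set v | [exists x in X, (P x \in B) && (v \in Q x)]].
pose Y := [set x in X | P x \in B].
pose S0 := (W :|: A :|: VB) :\: Y.
have YX : Y \subset X by apply/subsetP => x; rewrite inE => /andP[].
have YVB : Y \subset W :|: A :|: VB.
  apply/subsetP => x; rewrite inE => /andP[xX xB]; rewrite !inE; apply/orP; right.
  by apply/exists_inP; exists x; rewrite // xB; case: (QX xX).
have QS0 y : y \in Y -> Q y :\ y \subset S0.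
  rewrite inE => /andP[yX yB]; apply/subsetP => z /setD1P[zy zQ].
  rewrite in_setD !in_setU; apply/andP; split.
    rewrite inE; apply: contra zy => /andP[zX _]; apply/eqP; exact: Qown zQ.
  by apply/orP; right; rewrite inE; apply/exists_inP; exists y; rewrite // yB.
(* Off [W] and [A], a vertex of a component in [N] is charged to one cut only, and any other vertex
   only to [S1], less the spared ones. The sum is at most 2|W| + |A| + |~: W| - |J| + |N| - |Y| with
   |N| <= |B| <= |Y|, and Tutte-Berge bounds the rest by 2|M|. *)
have count : #|S0| + #|S1| <= 2 * #|M|.
  have c0 : #|S0| + #|Y| = #|W :|: A :|: VB|.
    by rewrite -(cardsID Y (W :|: A :|: VB)) (setIidPr YVB) addnC.
  pose C1 := [set v in V2 | (f v \in N) && (pt v \in B)].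
  pose C2 := [set v in V2 | (f v \in N) && (pt v \notin B)].
  pose C3 := [set v in V2 | (f v \notin N) && (v != k (f v))].
  have c1 : #|W :|: A :|: VB| <= #|W| + #|A| + #|C1|.
    apply: leq_trans (leq_add (leq_card_setU _ _) (leqnn _)).
    apply: leq_trans (leq_card_setU _ _); apply: subset_leq_card.
    apply/subsetP => v; rewrite !in_setU => /orP[->//|vB].
    have [vW|vW] := boolP (v \in W) => //; have [vA|vA] := boolP (v \in A) => //=.
    move: vB; rewrite inE => /exists_inP[x xX /andP[xB vx]].
    have vV : v \in V2 by rewrite inV2 vA vW.
    have ptB : pt v \in B by rewrite -(WE v x).
    by rewrite inE vV ptB rN.
  have c2 : #|S1| <= #|W| + #|A| + (#|C2| + #|C3|).
    apply: leq_trans (leq_add (leq_card_setU _ _) (leq_card_setU _ _)).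
    apply: leq_trans (leq_card_setU _ _); apply: subset_leq_card.
    apply/subsetP => v; rewrite inE !in_setU.
    have [vW|vW] := boolP (v \in W) => //; have [vA|vA] := boolP (v \in A) => //=.
    have vV : v \in V2 by rewrite inV2 vA vW.
    by rewrite [v \in C2]inE [v \in C3]inE vV /=; case: ifP => fN -> //=.
  have c3 : #|C1| + #|C2| = #|[set v in V2 | f v \in N]|.
    rewrite -(cardsID [set v | pt v \in B] [set v in V2 | f v \in N]).
    by congr (_ + _); apply: eq_card => v; rewrite !inE -!andbA; do ?bool_congr; rewrite andbC.
  have c4 : #|C3| + #|J :\: N| <= #|[set v in V2 | f v \notin N]|.
    have <- : #|k @: (J :\: N)| = #|J :\: N|.
      apply: card_in_imset => j j'; rewrite !in_setD => /andP[_ jJ] /andP[_ j'J] kk.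
      by have [_ <- _] := Hk j jJ; have [_ <- _] := Hk j' j'J; rewrite kk.
    rewrite -(cardsID [set v | v != k (f v)] [set v in V2 | f v \notin N]).
    apply: leq_add; apply: subset_leq_card; apply/subsetP => v.
      by rewrite !inE -!andbA => /and4P[-> -> -> ->].
    case/imsetP => j; rewrite in_setD => /andP[jN jJ] ->; have [kV fk _] := Hk j jJ.
    by rewrite inE in_set fk negbK eqxx /= inE kV fk.
  have c5 : #|[set v in V2 | f v \in N]| + #|[set v in V2 | f v \notin N]| = #|V2|.
    rewrite -(cardsID [set v | f v \in N] V2).
    by congr (_ + _); apply: eq_card => v; rewrite !inE // andbC.
  have c6 : #|J| <= #|J :\: N| + #|N|.
    by rewrite -(cardsID N J) addnC leq_add2l subset_leq_card // subsetIr.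
  have c7 : #|~: W| = #|V2| + #|A|.
    by rewrite -(cardsID A (~: W)) (setIidPr sA) addnC.
  have c8 : #|B| <= #|Y|.
    apply: leq_trans (leq_imset_card P Y); apply: subset_leq_card; apply/subsetP => p pB.
    have /imsetP[x xX px] := subsetP sB p pB.
    by apply/imsetP; exists x => //; rewrite inE xX -px.
  have c9 := covered_double Mm.
  move: TB; rewrite c9 -/V2 -/J -muln2; rewrite cM; lia.
have sep1 : 1 < #|Pt :\: B| -> 10 * #|Pt :\: B| <= #|S1|.
  move=> gt1.
  have Hp p : p \in Pt :\: B -> exists2 v, v \notin S1 & pt v = p.
    move=> pP; have [j pj /andP[jN /existsP[v /and4P[vW vA /eqP vp /eqP fv]]]] := Hpsi p pP.
    have jJ : j \in J by rewrite -fv; apply: imset_f; rewrite inV2 vA vW.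
    have [kV fk Hkp] := Hk j jJ; exists (k j); last exact: Hkp.
    by rewrite inE fk (negPf jN) eqxx; move: kV; rewrite inV2 => /andP[/negPf -> /negPf ->].
  have /card_gt0P[p0 p0P] : 0 < #|Pt :\: B| by apply: ltnW.
  have [v0 _ _] := Hp p0 p0P.
  have [kk Hkk] : exists kk : PT -> T, forall p, p \in Pt :\: B -> kk p \notin S1 /\ pt (kk p) = p.
    apply: (fin_all_exists (P := fun p v => p \in Pt :\: B -> v \notin S1 /\ pt v = p)) => p.
    have [pP|] := boolP (p \in Pt :\: B); last by exists v0.
    by have [v vS vp] := Hp p pP; exists v.
  have cK : #|kk @: (Pt :\: B)| = #|Pt :\: B|.
    by apply: card_in_imset => p p' /Hkk[_ e1] /Hkk[_ e2] kkk; rewrite -e1 -e2 kkk.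
  rewrite -cK; apply: (tough_card esym tgh); first by rewrite cK.
    by rewrite disjoints_subset; apply/subsetP => _ /imsetP[p /Hkk[kS _] ->]; rewrite in_setC.
  move=> _ _ /imsetP[p pP ->] /imsetP[p' p'P ->] ne; apply/negP => /connectP[s ps ls].
  have [kS kp] := Hkk p pP; have [k'S k'p] := Hkk p' p'P.
  have nB : pt (kk p) \notin B by rewrite kp; case/setDP: pP.
  (* Such a path never changes part: an edge that did would lie in one component of [f], where [S1]
     leaves either only vertices of parts in [B] or a single vertex. *)
  have H s' v : v \notin S1 -> pt v \notin B -> path (del_rel e S1) v s' -> pt (last v s') = pt v.
    elim: s' v => //= w s' IHs v vS vB /andP[/and3P[_ wS evw] pw].
    have ww : pt w = pt v; last by rewrite IHs ?ww.
    have S1E u : u \notin S1 -> [/\ u \notin W, u \notin A &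
        ~~ if f u \in N then pt u \notin B else u != k (f u)].
      by rewrite in_set !negb_or => /and3P.
    apply/eqP; apply: contraT => nvw.
    have [vW vA Cv] := S1E v vS; have [wW wA Cw] := S1E w wS.
    have fvw : f v = f w.
      by apply: Hf; rewrite -/V2 ?inV2 ?vW ?wW ?vA ?wA // /g /= evw eq_sym nvw.
    move: Cv Cw; rewrite -fvw; case: ifP => fN; first by rewrite (negPf vB).
    rewrite !negbK => /eqP vk /eqP wk.
    by move: evw; rewrite vk wk eirr.
  have := H s (kk p) kS nB ps; rewrite -ls k'p kp => pp.
  by rewrite pp eqxx in ne.
have sep0 : 1 < #|Y| -> 10 * #|Y| <= #|S0|.
  move=> gt1; have dY : [disjoint Y & S0] by rewrite disjoint_sym disjoints_subset /S0 setDE subsetIr.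
  apply: (tough_card esym tgh) => //; exact: Qsep.
have big0 : 0 < #|Y| -> 20 <= #|S0|.
  case/card_gt0P => y yY; have := subset_leq_card (QS0 y yY).
  have [yQ cQ] := QX (subsetP YX y yY); apply: leq_trans.
  by move: cQ; rewrite (cardsD1 y) yQ.
have cB : #|B| <= #|Y|.
  apply: leq_trans (leq_imset_card P Y); apply: subset_leq_card; apply/subsetP => p pB.
  have /imsetP[x xX px] := subsetP sB p pB.
  by apply/imsetP; exists x => //; rewrite inE xX -px.
have cPt : #|Pt| = #|Pt :\: B| + #|B|.
  by rewrite -(cardsID B Pt) (setIidPr sB) addnC.
exact: (cut_arith count sep1 sep0 big0 cB cPt small q2).
Qed.

End CrossingLinks.

(** * Even multigraphs and Euler circuits *)

Section Euler.
Variables (V : finType) (L : eqType) (hd tl : V -> L).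

Lemma perm_of_labels : perm_eq (map tl (enum V)) (map hd (enum V)) ->
  exists s : {perm V}, forall v, hd (s v) = tl v.
Proof.
have sz f : size (map f (enum V)) == #|V| by rewrite size_map cardE.
rewrite -[map hd _]/(tval (Tuple (sz L hd))) => /tuple_permP[p Ep].
have inj : injective (fun v => enum_val (p (enum_rank v))).
  by move=> v w /enum_val_inj/perm_inj/enum_rank_inj.
exists (perm inj) => v; rewrite permE.
have nthE f i : nth (tl v) (map f (enum V)) (@enum_rank V i) = f i.
  by rewrite (nth_map v) ?nth_enum_rank // -cardE.
rewrite -[RHS](nthE tl v) Ep.
rewrite (nth_map (enum_rank v)) ?size_enum_ord // nth_ord_enum (tnth_nth (tl v)) /=.
by have := nthE hd (enum_val (p (enum_rank v))); rewrite enum_valK => ->.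
Qed.

(* Euler's theorem for digraphs, the vertices being the labels and [v] the arc from
   [hd v] to [tl v]: two circuits meeting in a label are spliced by a transposition. *)
Lemma euler_circuit : perm_eq (map tl (enum V)) (map hd (enum V)) ->
  (forall O : {set V}, O != set0 ->
     (forall v w, v \in O -> (hd v == hd w) || (hd v == tl w) || (tl v == hd w) || (tl v == tl w) ->
        w \in O) -> O = setT) ->
  exists s : {perm V}, (forall v, hd (s v) = tl v) /\ forall v, porbit s v = setT.
Proof.
move=> /perm_of_labels[s0 Hs0] conn.
pose good (s : {perm V}) := [forall v, hd (s v) == tl v].
have g0 : good s0 by apply/forallP => v; rewrite Hs0.
case: (@arg_minnP _ s0 good (fun s => #|porbits s|) g0) => s /forallP gs mins.
have Hs v : hd (s v) = tl v by apply/eqP.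
exists s; split=> // v; apply: conn; first by apply/set0Pn; exists v; apply: porbit_id.
have tlO u w : u \in porbit s v -> tl u = tl w -> w \in porbit s v.
  move=> uv utl; apply: contraT => wv.
  have uw : u \notin porbit s w.
    apply: contra wv; move: uv; rewrite -!eq_porbit_mem => /eqP <- /eqP ->.
    exact: eqxx.
  have := porbits_mul_tperm s u w; rewrite /= uw.
  have -> : u != w by apply: contraNneq uw => ->; apply: porbit_id.
  (* As [u] and [w] have the same [tl], the transposition respects the labels, and it merges their
     orbits against minimality. *)
  have good' : good (tperm u w * s)%g.
    by apply/forallP => x; rewrite permM Hs; case: tpermP => // ->; rewrite ?utl.
  rewrite -[true.*2]/2 addn2 addn1 => -[cs]; have := mins _ good'.
  by rewrite -cs ltnn.
have preO u : ((s^-1)%g u \in porbit s v) = (u \in porbit s v).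
  have := porbit_perm s 1 ((s^-1)%g u); rewrite expg1 permKV => Eu.
  by rewrite ![_ \in porbit s v]porbit_sym Eu.
have hdE u : hd u = tl ((s^-1)%g u) by rewrite -Hs permKV.
move=> u w uO; rewrite !hdE -!orbA => /or4P[] /eqP E.
- by rewrite -preO; apply: tlO E; rewrite preO.
- by apply: tlO E; rewrite preO.
- by rewrite -preO; apply: tlO E.
- exact: tlO E.
Qed.

End Euler.

(** * Balanced orientations and T-joins *)

Section Orientation.
Variables (E L : finType).

Definition osrc (s t : E -> L) (b : E -> bool) x := if b x then t x else s x.
Definition otgt (s t : E -> L) (b : E -> bool) x := if b x then s x else t x.

(** By parity a nonloop edge [x] ending at [y] has a partner [z] at [y]. Replacing the two by one
    edge that bypasses [y] keeps degrees even, and an orientation of that edge lifts to a passage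
    through [y]. *)
Lemma even_orientation (R : {set E}) (s t : E -> L) :
  (forall v, ~~ odd (\sum_(x in R) ((s x == v) + (t x == v)))) ->
  exists b, forall v, \sum_(x in R) (osrc s t b x == v) = \sum_(x in R) (otgt s t b x == v) :> nat.
Proof.
move En : #|R| => n; elim: n R s t En => [|n IHn] R s t En ev.
  have -> : R = set0 by apply/eqP; rewrite -cards_eq0 En.
  by exists (fun _ => true) => v; rewrite !big_set0.
have /card_gt0P[x xR] : 0 < #|R| by rewrite En.
have cR' z : z \in R -> #|R :\ z| = n by move=> zR; move: En; rewrite (cardsD1 z) zR => -[].
have sumD z (F : E -> nat) : z \in R -> \sum_(i in R) F i = F z + \sum_(i in R :\ z) F i.
  by move=> zR; rewrite (big_setD1 z).
have [st|st] := eqVneq (s x) (t x).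
  have [v|b Hb] := IHn (R :\ x) s t (cR' x xR).
    by have := ev v; rewrite (sumD x) // st oddD addnn odd_double.
  by exists b => v; rewrite !(sumD x) // Hb /osrc /otgt st !if_same.
set y := t x in st.
have [z zR zy] : exists2 z, z \in R :\ x & (s z == y) (+) (t z == y).
  apply/exists_inP; apply: contraT => /exists_inPn H; have := ev y.
  rewrite (sumD x) // eqxx (negPf st) /= negbK.
  suff : ~~ odd (\sum_(i in R :\ x) ((s i == y) + (t i == y))) by move=> /negPf ->.
  elim/big_ind: _ => // [a a' /negPf ha /negPf ha'|i iR]; first by rewrite oddD ha ha'.
  by have := H i iR; case: (s i == y); case: (t i == y).
have zx : z != x by case/setD1P: zR.
have {}zR : z \in R by case/setD1P: zR.
pose w := if s z == y then t z else s z.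
pose t' i := if i == x then w else t i.
have xRz : x \in R :\ z by rewrite !inE eq_sym zx.
have sumD2 (F : E -> nat) : \sum_(i in R) F i = F z + (F x + \sum_(i in R :\ z :\ x) F i).
  by rewrite (sumD z) // (big_setD1 x).
have restE i : i \in R :\ z :\ x -> t' i = t i.
  by case/setD1P => /negPf ix _; rewrite /t' ix.
have t'x : t' x = w by rewrite /t' eqxx.
have sumE (F G : E -> nat) : (forall i, i \in R :\ z :\ x -> F i = G i) ->
   \sum_(i in R :\ z :\ x) F i = \sum_(i in R :\ z :\ x) G i by apply: eq_bigr.
have [v|b Hb] := IHn (R :\ z) s t' (cR' z zR).
  have := ev v; rewrite [X in ~~ odd X -> _]sumD2 [X in _ -> ~~ odd X](big_setD1 x xRz) /= t'x.
  rewrite (sumE (fun i => (s i == v) + (t' i == v)) (fun i => (s i == v) + (t i == v))); last first.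
    by move=> i iR; rewrite restE.
  move: zy; rewrite /w -/y; case: eqP => [->|_] /=; last move=> /eqP ->; rewrite !oddD !oddb.
    by case: (s x == v); case: (y == v); case: (t z == v); case: (odd _).
  by case: (s x == v); case: (y == v); case: (s z == v); case: (odd _).
pose c := if s z == y then b x else ~~ b x.
exists (fun i => if i == z then c else b i) => v.
have := Hb v; rewrite !(big_setD1 x xRz) /= !sumD2.
set B1 := \sum_(i in _) _; set B2 := \sum_(i in _) _ => E1.
rewrite (sumE _ (fun i => nat_of_bool (osrc s t' b i == v))); last first.
  move=> i iR; rewrite /osrc restE //; case/setD1P: iR => _ /setD1P[/negPf -> _] //.
rewrite [X in _ = _ + (_ + X)](sumE _ (fun i => nat_of_bool (otgt s t' b i == v))); last first.
  move=> i iR; rewrite /otgt restE //; case/setD1P: iR => _ /setD1P[/negPf -> _] //.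
rewrite -/B1 -/B2; move: E1; have xz : (x == z) = false by rewrite eq_sym (negPf zx).
rewrite /osrc /otgt eqxx xz t'x /c /w -/y.
move: zy; case: (s z =P y) => [->|_] /= => [_|/eqP ->]; case: (b x) => /= E1;
  by rewrite ?E1 addnCA ?E1.
Qed.

Definition pdeg (s t : E -> L) (J : {set E}) v :=
  \big[addb/false]_x ((x \in J) && ((s x == v) (+) (t x == v))).

Lemma pdegE s t J v : pdeg s t J v = odd (\sum_(x in J) ((s x == v) + (t x == v))).
Proof.
rewrite (big_morph odd oddD (erefl _)) big_mkcond; apply: eq_bigr => x _.
by case: (x \in J) => //=; rewrite oddD !oddb.
Qed.

Lemma big_addb_eq (I : finType) (i : I) : \big[addb/false]_j (i == j) = true.
Proof.
rewrite (bigD1 i) //= eqxx big1 // => j /negPf ji.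
by rewrite eq_sym.
Qed.

Lemma pdeg_sum s t J : \big[addb/false]_v pdeg s t J v = false.
Proof.
rewrite exchange_big big1 // => x _; rewrite -big_distrr /= big_split /= !big_addb_eq.
exact: andbF.
Qed.

(** [J] is the sum modulo 2 of the edges of a walk; an edge traversed twice cancels. *)
Lemma connect_pdeg s t (R : {set E}) y z : connect (madj s t R) y z ->
  exists2 J : {set E}, J \subset R & forall v, pdeg s t J v = (y == v) (+) (z == v).
Proof.
case/connectP => p pp ->{z}; elim: p y pp => [|u p IHp] y /=.
  exists set0; first exact: sub0set.
  by move=> v; rewrite addbb /pdeg big1 // => x _; rewrite inE.
case/andP => /existsP[x /andP[xR xyu]] /IHp[J sJ HJ].
exists [set i | (i \in J) (+) (i == x)].
  by apply/subsetP => i; rewrite inE; case: eqP => [-> //|_]; rewrite addbF; apply: (subsetP sJ).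
move=> v; rewrite /pdeg; under eq_bigr => i _ do rewrite inE andb_addl.
rewrite big_split /= -/(pdeg s t J v) HJ (bigD1 x) //= eqxx /= big1 ?addbF; last first.
  by move=> i /negPf ->.
by case/orP: xyu => /andP[/eqP -> /eqP ->]; case: (u == v); case: (y == v); case: (last u p == v).
Qed.

(** [J] is the sum modulo 2 of paths in [R2] from [y] to the vertices of odd degree in [R1]. By
    [pdeg_sum] their number is even, so the ends at [y] cancel. *)
Lemma even_superset s t (R1 R2 : {set E}) (y : L) : [disjoint R1 & R2] ->
  (forall z, connect (madj s t R2) z y) ->
  exists2 J : {set E}, J \subset R2 &
    forall v, ~~ odd (\sum_(x in R1 :|: J) ((s x == v) + (t x == v))).
Proof.
move=> dR conn.
have [K HK] : exists K : L -> {set E}, forall z, K z \subset R2 /\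
    forall v, pdeg s t (K z) v = (z == v) (+) (y == v).
  apply: (fin_all_exists (P := fun (z : L) (K : {set E}) => K \subset R2 /\
    forall v, pdeg s t K v = (z == v) (+) (y == v))) => z.
  by have [J sJ HJ] := connect_pdeg (conn z); exists J.
pose p := pdeg s t R1.
pose J := [set x | \big[addb/false]_(z | p z) (x \in K z)].
have sJ : J \subset R2.
  apply/subsetP => x; rewrite inE; apply: contraTT => xR; rewrite big1 // => z _.
  by apply: contraNF xR; apply: (subsetP (proj1 (HK z))).
exists J => // v; rewrite -pdegE.
have -> : pdeg s t (R1 :|: J) v = pdeg s t R1 v (+) pdeg s t J v.
  rewrite -big_split; apply: eq_bigr => x _; rewrite in_setU.
  case: (boolP (x \in R1)) => //= xR1.
  have -> : x \in J = false.
    by apply: contraTF xR1 => /(subsetP sJ) xR2; rewrite (disjointFl dR xR2).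
  by rewrite addbF.
suff -> : pdeg s t J v = p v by rewrite addbb.
rewrite /pdeg; under eq_bigr => x _ do rewrite inE big_distrl.
rewrite exchange_big /=.
under eq_bigr => z _ do rewrite -/(pdeg s t (K z) v) (proj2 (HK z)).
rewrite big_split /=.
have -> : \big[addb/false]_(z | p z) (y == v) = false.
  transitivity (\big[addb/false]_z (p z && (y == v))).
    by rewrite big_mkcond; apply: eq_bigr => z _; case: (p z).
  by rewrite -big_distrl /= pdeg_sum.
rewrite addbF big_mkcond (bigD1 v) //= eqxx big1 ?addbF; first by case: (p v).
by move=> z /negPf ->; rewrite if_same.
Qed.

End Orientation.

(** * Hamilton cycles *)

Section Hamilton.
Variables (T : finType) (e : rel T).
Hypotheses (esym : symmetric e) (eirr : irreflexive e) (T3 : 2 < #|T|).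

Lemma hamiltonian_perm (s : {perm T}) : (forall v, porbit s v = setT) ->
  (forall v, s v = v \/ e v (s v)) -> hamiltonian e.
Proof.
move=> so se; have /card_gt0P[x _] : 0 < #|T| by apply: leq_trans T3.
have nfix v : s v <> v.
  move=> sv; have : #|porbit s v| <= 1; last by rewrite so cardsT leqNgt (ltnW T3).
  rewrite -(cards1 v); apply: subset_leq_card; apply/subsetP => w /porbitP[i ->].
  by rewrite inE; elim: i => [|i /eqP IHi]; rewrite ?expg0 ?perm1 // expgSr permM IHi sv.
have inO y : y \in fingraph.orbit s x.
  have : y \in porbit s x by rewrite so inE.
  by case/porbitP => i ->; rewrite -fconnect_orbit permX fconnect_iter.
exists (fingraph.orbit s x); split=> //; split.
  apply: (introT andP); split; last exact: orbit_uniq.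
  apply: sub_cycle (cycle_orbit (@perm_inj _ s) x) => a b /eqP <-.
  by case: (se a) => // /nfix.
rewrite (leq_trans T3) // cardE; apply: uniq_leq_size; first exact: enum_uniq.
by move=> y _.
Qed.

(** With a single label all arcs meet, so [euler_circuit] yields a cyclic permutation of the
    vertices. *)
Lemma hamiltonian_complete : complete_graph e -> hamiltonian e.
Proof.
move=> /forallP comp.
have [|O O0 HO|s [_ so]] := @euler_circuit T unit (fun _ => tt) (fun _ => tt).
- exact: perm_refl.
- apply/setP => w; rewrite inE; case/set0Pn: O0 => v vO; exact: HO vO _.
apply: (hamiltonian_perm so) => v; have [->|ne] := eqVneq (s v) v; [by left | right].
by have /forallP/(_ (s v))/implyP := comp v; apply; rewrite eq_sym.
Qed.

Hypothesis tgh : forall S : {set T}, separating e S -> 10 * ncomp_del e S <= #|S|.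
Variables (X : {set T}) (Q : T -> {set T}).
Hypothesis QX : forall x, x \in X -> x \in Q x /\ 20 < #|Q x|.
Hypothesis Qcl : forall x, {in Q x &, forall y z, y != z -> e y z}.
Hypothesis Qcov : forall v, exists2 x, x \in X & v \in Q x.
Hypothesis Qown : forall x y, x \in X -> y \in X -> x \in Q y -> x = y.
Hypothesis Qsep : forall (Y S : {set T}), Y \subset X -> [disjoint Y & S] ->
  (forall y, y \in Y -> Q y :\ y \subset S) ->
  {in Y &, forall x y, x != y -> ~~ connect (del_rel e S) x y}.

(** * Spanning trees in two layers of links *)

Local Notation LT := {l : T * T * (T * T) | is_link e X Q l}.
Local Notation XT := {x : T | x \in X}.
Variable x0 : XT.

Definition lsrc (l : LT) : XT := insubd x0 (val l).1.1.
Definition ltgt (l : LT) : XT := insubd x0 (val l).1.2.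

Lemma val_lsrc l : val (lsrc l) = (val l).1.1.
Proof. by rewrite val_insubd; case/and5P: (valP l) => ->. Qed.

Lemma val_ltgt l : val (ltgt l) = (val l).1.2.
Proof. by rewrite val_insubd; case/and5P: (valP l) => _ ->. Qed.

Definition lconf : rel (LT * bool) := fun p p' =>
  ~~ [disjoint lverts (val p.1) & lverts (val p'.1)].
Definition esrc (p : LT * bool) := (lsrc p.1, p.2).
Definition etgt (p : LT * bool) := (ltgt p.1, p.2).

Lemma lconf_refl (l : LT) b b' : lconf (l, b) (l, b').
Proof.
by apply/negP => /disjointFr/(_ (set21 _ _)); rewrite set21.
Qed.

(** The layer with more classes of [F] provides the partition for [crossing_links]. The links found
    are disjoint, so each vertex of a link in [Z] spoils at most one of them. *)
Lemma links_undominated (F : {set LT * bool}) : 2 < mcomp esrc etgt F ->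
  exists I : {set LT * bool},
     [/\ I \subset ~: F, indep lconf I &
      forall Z : {set LT * bool}, Z \subset ~: F -> #|Z| < mcomp esrc etgt F - 2 ->
        exists2 v, v \in I & v \notin Z /\ forall z, z \in Z -> ~~ lconf z v].
Proof.
move=> F2; pose C b := [set mclass esrc etgt F (x, b) | x : XT].
have le : mcomp esrc etgt F <= #|C true| + #|C false|.
  apply: leq_trans (leq_card_setU _ _); apply: subset_leq_card.
  apply/subsetP => _ /imsetP[[x b] _ ->]; rewrite in_setU.
  by case: b; apply/orP; [left | right]; apply: imset_f.
have [b Hb] : exists b, mcomp esrc etgt F <= 2 * #|C b|.
  by have [h|h] := leqP #|C true| #|C false|; [exists false | exists true]; move: le h; lia.
pose P x := mclass esrc etgt F (insubd x0 x, b).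
have PC : P @: X = C b.
  apply/setP => c; apply/imsetP/imsetP => -[x xX ->]; first by exists (insubd x0 x).
  by exists (val x); rewrite ?(valP x) // /P valKd.
have [|M [ML Mdis Mc]] := @crossing_links T e esym eirr tgh X Q QX Qcov Qown Qsep _ P.
  by rewrite PC; move: F2 Hb; lia.
pose I : {set LT * bool} := [set p | (p.2 == b) && (val p.1 \in M)].
have cI : #|M| <= #|I|.
  apply: leq_trans (leq_imset_card (fun p : LT * bool => val p.1) I); apply: subset_leq_card.
  apply/subsetP => l lM; have /andP[ll _] := ML l lM.
  by apply/imsetP; exists (Sub l ll, b); rewrite ?inE /= ?eqxx.
have Idis : {in I &, forall p p', p != p' -> [disjoint lverts (val p.1) & lverts (val p'.1)]}.
  move=> [l a] [l' a']; rewrite !inE /= => /andP[/eqP -> lM] /andP[/eqP -> l'M].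
  by rewrite xpair_eqE eqxx andbT => ne; apply: Mdis.
exists I; split.
- apply/subsetP => -[l a]; rewrite inE /= => /andP[/eqP -> lM]; rewrite inE.
  apply/negP => /(@mclass_edge _ _ esrc etgt); rewrite /esrc /etgt /= => E.
  by have /andP[_ /eqP[]] := ML _ lM; rewrite /P -/(lsrc l) -/(ltgt l).
- by apply/indepP => p p' pI p'I ne; rewrite negbK; apply: Idis.
move=> Z _ cZ.
have [/exists_inP[v vI /andP[vZ /forall_inP hv]]|/exists_inPn H] :=
  boolP [exists v in I, (v \notin Z) && [forall z in Z, ~~ lconf z v]]; first by exists v.
pose ZV := \bigcup_(z in Z) lverts (val z.1).
have cZV : #|ZV| <= 2 * #|Z|.
  have : #|ZV| <= \sum_(z in Z) #|lverts (val z.1)|.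
    apply: (big_ind2 (fun (A : {set T}) n => #|A| <= n)) => [|A n A' n' hA hA'|//].
      by rewrite cards0.
    exact: leq_trans (leq_card_setU _ _) (leq_add hA hA').
  move/leq_trans; apply; rewrite mulnC -sum_nat_const; apply: leq_sum => z _.
  by rewrite cards2; case: (_ != _).
have [g Hg] : exists g : LT * bool -> T, forall p, p \in I -> g p \in lverts (val p.1) /\ g p \in ZV.
  apply: (fin_all_exists (P := fun (p : LT * bool) v => p \in I -> v \in lverts (val p.1) /\ v \in ZV)) => p.
  have [pI|] := boolP (p \in I); last by exists (val x0).
  have := H p pI; rewrite negb_and negbK => /orP[pZ|/forall_inPn[z zZ]].
    exists (val p.1).2.1 => _; split; first exact: set21.
    by apply/bigcupP; exists p; rewrite // set21.
  rewrite negbK => /pred0Pn[v /andP[vz vp]]; exists v => _; split=> //.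
  by apply/bigcupP; exists z.
have cIZ : #|I| <= #|ZV|.
  rewrite -(@card_in_imset _ _ g I).
    by apply: subset_leq_card; apply/subsetP => _ /imsetP[p pI ->]; case: (Hg p pI).
  move=> p p' pI p'I gg; apply/eqP; apply: contraT => ne.
  have [gp _] := Hg p pI; have [gp' _] := Hg p' p'I.
  by have := disjointFr (Idis p p' pI p'I ne) gp; rewrite gg gp'.
have : 4 * #|C b| <= #|M| + 5 by rewrite -PC.
move: cI cIZ cZV cZ Hb F2; lia.
Qed.

Lemma layer_connect (R : {set LT * bool}) y z : connect (madj esrc etgt R) y z ->
  y.2 = z.2 /\ connect (madj lsrc ltgt [set l | (l, y.2) \in R]) y.1 z.1.
Proof.
case/connectP => p pp ->{z}; elim: p y pp => [|u p IHp] y /=; first by rewrite connect0.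
case/andP => /existsP[[l b] /andP[lR lyu]] /IHp[<- cu].
have [yb ub adj] : [/\ y.2 = b, u.2 = b & ((lsrc l == y.1) && (ltgt l == u.1)) || ((lsrc l == u.1) && (ltgt l == y.1))].
  by case/orP: lyu => /andP[/eqP <- /eqP <-] /=; rewrite !eqxx ?orbT.
split; first by rewrite yb ub.
rewrite yb -ub; apply: connect_trans cu; apply: connect1; apply/existsP; exists l.
by rewrite inE ub lR adj.
Qed.

Lemma two_spanning : exists2 R : {set LT * bool}, indep lconf R &
  forall b x y, connect (madj lsrc ltgt [set l | (l, b) \in R]) x y.
Proof.
have lconf_sym : symmetric lconf by move=> p q; rewrite /lconf disjoint_sym.
(* Otherwise [links_undominated], applied to all links, would produce a link outside [setT]. *)
have cT : mcomp esrc etgt setT <= 2.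
  rewrite leqNgt; apply/negP => gt2; have [I [sI _ /(_ set0)]] := links_undominated gt2.
  rewrite sub0set cards0 subn_gt0 => /(_ isT gt2) [v vI _].
  by have := subsetP sI v vI; rewrite !inE.
have [R iR cR] := conflict_free_connected lconf_sym cT links_undominated.
exists R => // b x y.
suff /layer_connect[] : connect (madj esrc etgt R) (x, b) (y, b) by [].
apply: contraT => nc; move: cR; rewrite leqNgt => /negP[].
pose c1 := mclass esrc etgt R (x, b); pose c2 := mclass esrc etgt R (y, b).
pose c3 := mclass esrc etgt R (x, ~~ b).
have n12 : c1 != c2 by apply/negP => /eqP/mclass_eqP; rewrite (negPf nc).
have nb z : mclass esrc etgt R (z, b) != c3.
  by apply/negP => /eqP/mclass_eqP/layer_connect[/=]; case: b {nc c1 c2 c3 n12}.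
have <- : #|[set c1; c2; c3]| = 3.
  by rewrite -setUA cardsU1 cards2 !inE negb_or n12 !nb.
apply: subset_leq_card; apply/subsetP => c; rewrite !inE -orbA.
by case/or3P => /eqP ->; apply: imset_f.
Qed.

(** Each vertex [v] becomes an arc from [hd v] to [tl v]. The labels are the cliques [inl x] and, in
    the middle of each selected link that is an edge, a label [inr (fv l)]; vertices on no selected
    link are loops at a clique. Consecutive arcs of an Euler circuit lie in a common clique or are
    the two ends of a link. *)
Lemma hamiltonian_links : hamiltonian e.
Proof.
have [R iR cR] := two_spanning.
pose R1 := [set l | (l, true) \in R]; pose R2 := [set l | (l, false) \in R].
have Rdis l l' b b' : (l, b) \in R -> (l', b') \in R -> (l, b) != (l', b') ->
    [disjoint lverts (val l) & lverts (val l')].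
  by move=> lR l'R ne; have /indepP/(_ _ _ lR l'R ne) := iR; rewrite negbK.
have dR : [disjoint R1 & R2].
  rewrite disjoints_subset; apply/subsetP => l; rewrite !inE => l1; apply/negP => l2.
  have := Rdis l l true false l1 l2; rewrite xpair_eqE andbF => /(_ isT).
  by apply/negP/(lconf_refl l true true).
have [J sJ ev] := even_superset dR (fun z => cR false z x0).
set Rs := R1 :|: J in ev.
have [b Hb] := even_orientation ev.
pose inX := osrc lsrc ltgt b; pose outX := otgt lsrc ltgt b.
pose fv (l : LT) := if b l then (val l).2.2 else (val l).2.1.
pose sv (l : LT) := if b l then (val l).2.1 else (val l).2.2.
have fvQ l : fv l \in Q (val (inX l)).
  rewrite /fv /inX /osrc; case/and5P: (valP l) => _ _ h1 h2 _.
  by case: (b l); rewrite ?val_lsrc ?val_ltgt.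
have svQ l : sv l \in Q (val (outX l)).
  rewrite /sv /outX /otgt; case/and5P: (valP l) => _ _ h1 h2 _.
  by case: (b l); rewrite ?val_lsrc ?val_ltgt.
have fve l : fv l != sv l -> e (fv l) (sv l).
  rewrite /fv /sv; case/and5P: (valP l) => _ _ _ _ h.
  by case: (b l) h => /orP[/eqP ->|h]; rewrite ?eqxx // esym.
have lvE l v : (v \in lverts (val l)) = (v == fv l) || (v == sv l).
  by rewrite !inE /fv /sv; case: (b l); rewrite // orbC.
have Rsdis l l' : l \in Rs -> l' \in Rs -> l != l' -> [disjoint lverts (val l) & lverts (val l')].
  have inR k : k \in Rs -> exists c, (k, c) \in R.
    rewrite in_setU => /orP[|/(subsetP sJ)]; rewrite inE => kR; by [exists true | exists false].
  move=> /inR[c lR] /inR[c' l'R] ne; apply: Rdis lR l'R _.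
  by rewrite xpair_eqE (negPf ne).
pose own v := [pick l in Rs | v \in lverts (val l)].
have ownE l v : l \in Rs -> v \in lverts (val l) -> own v = Some l.
  move=> lR vl; rewrite /own; case: pickP => [l' /andP[l'R vl']|/(_ l)]; last by rewrite lR vl.
  congr Some; apply/eqP; apply: contraT => ne.
  by have := disjointFr (Rsdis _ _ l'R lR ne) vl'; rewrite vl.
have ownS v l : own v = Some l -> l \in Rs /\ v \in lverts (val l).
  by rewrite /own; case: pickP => // l' /andP[l'R vl'] [<-].
have ownf l : l \in Rs -> own (fv l) = Some l by move=> lR; apply: ownE; rewrite // lvE eqxx.
have owns l : l \in Rs -> own (sv l) = Some l by move=> lR; apply: ownE; rewrite // lvE eqxx orbT.
have [h Hh] : exists h : T -> XT, forall v, v \in Q (val (h v)).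
  apply: (fin_all_exists (P := fun v (x : XT) => v \in Q (val x))) => v.
  by have [x xX vx] := Qcov v; exists (Sub x xX).
pose hd v : XT + T := if own v is Some l then
  if v == fv l then inl (inX l) else inr (fv l) else inl (h v).
pose tl v : XT + T := if own v is Some l then
  if v == sv l then inl (outX l) else inr (fv l) else inl (h v).
have hdf l : l \in Rs -> hd (fv l) = inl (inX l) by move=> lR; rewrite /hd ownf // eqxx.
have tls l : l \in Rs -> tl (sv l) = inl (outX l) by move=> lR; rewrite /tl owns // eqxx.
have hds l : l \in Rs -> fv l != sv l -> hd (sv l) = inr (fv l).
  by move=> lR /negPf ne; rewrite /hd owns // eq_sym ne.
have tlf l : l \in Rs -> fv l != sv l -> tl (fv l) = inr (fv l).
  by move=> lR /negPf ne; rewrite /tl ownf // ne.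
have hdQ v x : hd v = inl x -> v \in Q (val x).
  rewrite /hd; case: (own v) => [l|[<-]]; last exact: Hh.
  by case: eqP => // -> [<-].
have tlQ v x : tl v = inl x -> v \in Q (val x).
  rewrite /tl; case: (own v) => [l|[<-]]; last exact: Hh.
  by case: eqP => // -> [<-].
have hd_inr v u : hd v = inr u -> exists2 l, l \in Rs & [/\ v = sv l, u = fv l & fv l != sv l].
  rewrite /hd; case El : (own v) => [l|//]; have [lR] := ownS v l El; rewrite lvE.
  case: (v =P fv l) => // /eqP nv /= /eqP vs [<-]; exists l => //; split=> //.
  by rewrite eq_sym -vs.
have tl_inr v u : tl v = inr u -> exists2 l, l \in Rs & [/\ v = fv l, u = fv l & fv l != sv l].
  rewrite /tl; case El : (own v) => [l|//]; have [lR] := ownS v l El; rewrite lvE.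
  case: (v =P sv l) => // /eqP nv; rewrite orbF => /eqP vs [<-]; exists l => //; split=> //.
  by rewrite -vs.
pose U0 := [seq v <- enum T | own v == None].
pose D := enum Rs; pose D2 := [seq l <- D | fv l != sv l].
(* Used twice, with [fv] and [sv] exchanged, so that heads and tails agree block by block. *)
have enumE (f g : LT -> T) : (forall l, l \in Rs -> own (f l) = Some l) ->
    (forall l, l \in Rs -> own (g l) = Some l) ->
    (forall l v, (v \in lverts (val l)) = (v == f l) || (v == g l)) ->
    (forall l, (f l == g l) = (fv l == sv l)) ->
    perm_eq (enum T) (U0 ++ map f D ++ map g D2).
  move=> of_ og fgE fg; apply: uniq_perm; first exact: enum_uniq.
    have inD l : l \in D -> l \in Rs by rewrite mem_enum.
    have inD2 l : l \in D2 -> l \in Rs /\ fv l != sv l.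
      by rewrite mem_filter => /andP[? /inD].
    have fgI (f' : LT -> T) : (forall l, l \in Rs -> own (f' l) = Some l) ->
        {in Rs &, injective f'}.
      by move=> o l l' lR l'R ff; have := o l lR; rewrite ff o // => -[].
    rewrite !cat_uniq filter_uniq ?enum_uniq //=; apply/and4P; split.
    - apply/hasPn => v; rewrite mem_cat => /orP[] /mapP[l lD ->]; rewrite mem_filter.
        by rewrite of_ ?inD.
      by have [lR _] := inD2 l lD; rewrite og.
    - rewrite map_inj_in_uniq ?enum_uniq // => l l' /inD lR /inD l'R; exact: fgI.
    - apply/hasPn => v /mapP[l /inD2[lR ne] ->]; apply/mapP => -[l' /inD l'R E].
      have E' : l = l' by have := og l lR; rewrite E of_ // => -[].
      by move: ne; rewrite -fg E' -E' E E' eqxx.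
    rewrite map_inj_in_uniq; first exact/filter_uniq/enum_uniq.
    by move=> l l' /inD2[lR _] /inD2[l'R _]; apply: fgI.
  move=> v; rewrite mem_enum !mem_cat mem_filter mem_enum inE; symmetry.
  case El : (own v) => [l|//]; have [lR] := ownS v l El; rewrite fgE /= => /orP[] /eqP ->.
    by rewrite (map_f f) ?mem_enum.
  case: (eqVneq (f l) (g l)) => [<-|ne]; first by rewrite (map_f f) ?mem_enum.
  by rewrite (map_f g) ?orbT // mem_filter -fg ne mem_enum.
have peq : perm_eq (map tl (enum T)) (map hd (enum T)).
  have p1 : perm_eq (enum T) (U0 ++ map sv D ++ map fv D2).
    by apply: enumE => // l v; rewrite lvE orbC.
  have p2 : perm_eq (enum T) (U0 ++ map fv D ++ map sv D2) by apply: enumE.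
  apply: perm_trans (perm_map tl p1) _; rewrite perm_sym.
  apply: perm_trans (perm_map hd p2) _; rewrite !map_cat -!map_comp.
  have -> : [seq hd i | i <- U0] = [seq tl i | i <- U0].
    apply/eq_in_map => v; rewrite mem_filter => /andP[/eqP ov _].
    by rewrite /hd /tl ov.
  rewrite perm_cat2l.
  have -> : [seq (hd \o sv) i | i <- D2] = [seq (tl \o fv) i | i <- D2].
    apply/eq_in_map => l; rewrite mem_filter mem_enum => /andP[ne lR] /=.
    by rewrite hds // tlf.
  rewrite perm_cat2r.
  have -> : [seq (hd \o fv) i | i <- D] = [seq inl i | i <- [seq inX i | i <- D]].
    by rewrite -map_comp; apply/eq_in_map => l; rewrite mem_enum /= => /hdf.
  have -> : [seq (tl \o sv) i | i <- D] = [seq inl i | i <- [seq outX i | i <- D]].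
    by rewrite -map_comp; apply/eq_in_map => l; rewrite mem_enum /= => /tls.
  apply: perm_map; apply/allP => x _ /=.
  have cnt (f : LT -> XT) : count_mem x [seq f i | i <- D] = \sum_(l in Rs) (f l == x).
    by rewrite count_map -sum1_count big_mkcond big_enum.
  by rewrite !cnt; apply/eqP; apply: Hb.
(* A set of arcs closed under meeting contains both ends of a link or neither, so its cliques are
   closed along [R1], which connects all cliques. *)
have [O /set0Pn[w wO] HO|s [Hs so]] := euler_circuit peq.
  pose LO := [set x : XT | [exists v in O, (hd v == inl x) || (tl v == inl x)]].
  have inLO v x : v \in O -> (hd v == inl x) || (tl v == inl x) -> x \in LO.
    by move=> vO vx; rewrite inE; apply/exists_inP; exists v.
  have LOin v x : x \in LO -> (hd v == inl x) || (tl v == inl x) -> v \in O.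
    rewrite inE => /exists_inP[u uO] /orP[] /eqP ux /orP[] /eqP vx;
    by apply: HO uO _; rewrite ux vx eqxx ?orbT.
  have haslab v : exists x, (hd v == inl x) || (tl v == inl x).
    rewrite /hd /tl; case El : (own v) => [l|]; last by exists (h v); rewrite eqxx.
    have [lR] := ownS v l El; rewrite lvE; case: (v == fv l) => /= vl.
      by exists (inX l); rewrite eqxx.
    by exists (outX l); rewrite vl eqxx.
  have fsO l : l \in Rs -> (fv l \in O) = (sv l \in O).
    move=> lR; have [->//|ne] := eqVneq (fv l) (sv l).
    by apply/idP/idP => /HO; apply; rewrite hds ?tlf ?eqxx ?orbT.
  have inout l : l \in Rs -> (inX l \in LO) = (outX l \in LO).
    move=> lR; apply/idP/idP => xL.
      have : fv l \in O by apply: (LOin _ _ xL); rewrite hdf // eqxx.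
      by rewrite fsO // => sO; apply: (inLO _ _ sO); rewrite tls // eqxx orbT.
    have : sv l \in O by apply: (LOin _ _ xL); rewrite tls // eqxx orbT.
    by rewrite -fsO // => sO; apply: (inLO _ _ sO); rewrite hdf // eqxx.
  have closed x y : madj lsrc ltgt R1 x y -> x \in LO -> y \in LO.
    case/existsP => l /andP[lR lxy].
    have /inout : l \in Rs by rewrite in_setU lR.
    rewrite /inX /outX /osrc /otgt; case: (b l);
    by case/orP: lxy => /andP[/eqP -> /eqP ->] ->.
  have [x1 wx1] := haslab w; have x1L := inLO _ _ wO wx1.
  have allL y : y \in LO.
    have /connectP[p pp ->] := cR true x1 y.
    by elim: p x1 x1L pp {wx1} => //= z p IHp u uL /andP[/closed/(_ uL) zL]; apply: IHp.
  apply/setP => v; rewrite inE; have [x vx] := haslab v; exact: LOin (allL x) vx.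
apply: (hamiltonian_perm so) => v.
have [->|ne] := eqVneq (s v) v; [by left | right].
case Et : (tl v) => [x|u].
  by apply: (Qcl (x := val x)); [apply: tlQ | apply: hdQ; rewrite Hs | rewrite eq_sym].
have [l lR [vl ul nl]] := tl_inr v u Et.
have [l' l'R [sl' ul' _]] := hd_inr (s v) u (etrans (Hs v) Et).
have El : l' = l by have := ownf l' l'R; rewrite -ul' ul ownf // => -[].
by rewrite sl' El vl; apply: fve.
Qed.

End Hamilton.

Lemma tough_ncomp (T : finType) (e : rel T) (n : nat) : ~~ complete_graph e -> tough e n%:R%R ->
  forall S : {set T}, separating e S -> n * ncomp_del e S <= #|S|.
Proof.
move=> nc; rewrite /tough /toughness (negPf nc) => le S sS.
have c0 : (0 < (ncomp_del e S)%:R :> rat)%R by rewrite ltr0n; apply: ltnW.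
have := le_trans le (bigmin_le_cond _ _ sS).
by rewrite lee_fin ler_pdivlMr // -natrM ler_nat.
Qed.

Theorem theorem1p2 (T : finType) (e : rel T) :
  simple_graph e -> 3 <= #|T| -> chordal e -> tough e 10%:R%R ->
  hamiltonian e.
Proof.
move=> [esym eirr] T3 ch tgh.
have [/(hamiltonian_complete T3) //|nc] := boolP (complete_graph e).
have tgh' := tough_ncomp nc tgh.
have [X [Q [QX Qcl Qcov Qown Qsep]]] := clique_cover esym eirr ch tgh' nc.
have /card_gt0P[v _] : 0 < #|T| by apply: leq_trans T3.
have [x xX _] := Qcov v.
exact: (hamiltonian_links esym eirr T3 tgh' QX Qcl Qcov Qown Qsep (Sub x xX)).
Qed.
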